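(* (1) Let $K\subseteq G$ be a closed inclusion of affine algebraic groups over $\Bbbk$ and $R$ a rational $G$-module algebra. Suppose that the action of $K$ on $G$ by translations is linearly reductive. If the action of $G$ on $R$ is linearly reductive, then the action of $K$ on $R$ is linearly reductive. (2) Let $K\triangleleft G$ be a closed normal inclusion of affine algebraic groups over $\Bbbk$ and $R$ a rational $G$-module algebra. Then the action of $G$ on $R$ is linearly reductive if and only if the action of $K$ on $R$ is linearly reductive and the action of $G/K$ on ${}^K R$ is linearly reductive.
   Context: $\Bbbk$ is an algebraically closed field; all algebras are commutative. For an affine algebraic group $G$ and a rational $G$-module algebra $R$ (commutative $\Bbbk$-algebra and rational $G$-module with $G$ acting by algebra automorphisms), a $(G,R)$-module is a rational $G$-module $M$ that is also an $R$-module with $x\cdot(rm) = (x\cdot r)(x\cdot m)$; morphisms are $G$-equivariant $R$-linear maps; ${}^G M$ is the set of $G$-fixed elements. The action of $G$ on $R$ is linearly reductive if for every $(G,R)$-module $M$, every $G$-stable ideal $J\subseteq R$ and every surjective morphism of $(G,R)$-modules $\lambda: M\to R/J$, there exists $m\in {}^G M$ with $\lambda(m)=1+J$. The action of $G$ on an affine variety $X$ is linearly reductive if the induced action on $\Bbbk[X]$ is. The action of $K$ on $G$ by translations is $(g,k)\mapsto gk$, so $K$ acts on $\Bbbk[G]$ by $(k\cdot f)(g)=f(gk)$. A $G$-module algebra is regarded as a $K$-module algebra by restriction, and when $K$ is normal, ${}^K R$ is a $G/K$-module algebra with the induced action. *)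

(* Defs.v *)
From HB Require Import structures.
From mathcomp Require Import all_boot all_order all_algebra.
From mathcomp Require Import boolp.

Set Implicit Arguments.
Unset Strict Implicit.
Unset Printing Implicit Defensive.

Import GRing.Theory.
Import Quotient.
Local Open Scope ring_scope.
Local Open Scope quotient_scope.

(* An affine algebraic group: a group of points together with a finitely
   generated algebra [coord] of functions on it, whose algebra homomorphisms
   to k are exactly the evaluations at points, each at a single point, and for
   which multiplication and inversion are morphisms ([coord_mul] says that
   f(gh) = sum_j a_j(g) b_j(h) for some a_j, b_j in [coord]).
   [eval g f] is f(g). *)
Record affine_group (k : closedFieldType) := AffineGroup {
  points :> groupType;
  coord : comAlgType k;
  eval : points -> {lrmorphism coord -> k^o};
  eval_inj : forall f, (forall g, eval g f = 0) -> f = 0;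
  eval_points : forall phi : {lrmorphism coord -> k^o},
    exists! g, forall f, phi f = eval g f;
  coord_fg : exists s : seq coord, forall S : {pred coord},
    GRing.subalg_closed S -> {subset s <= S} -> forall f, f \in S;
  coord_mul : forall f, exists (n : nat) (a b : 'I_n -> coord), forall g h,
    eval (g * h)%g f = \sum_j (eval g (a j) : k) * (eval h (b j) : k);
  coord_inv : forall f, exists f', forall g, eval g f' = eval g^-1%g f
}.

Record group_morphism (k : closedFieldType) (H G : affine_group k) := GroupMorphism {
  gmor :> H -> G;
  gmorM : forall x y, gmor (x * y)%g = (gmor x * gmor y)%g;
  gmor_regular : forall f : coord G, exists f' : coord H,
    forall x, eval x f' = eval (gmor x) f
}.

(* The comorphism k[G] -> k[K] is surjective; in particular i is injective. *)
Definition closed_inclusion (k : closedFieldType) (K G : affine_group k)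
    (i : group_morphism K G) : Prop :=
  forall f : coord K, exists f' : coord G, forall x, eval (i x) f' = eval x f.

Definition normal_inclusion (k : closedFieldType) (K G : affine_group k)
    (i : group_morphism K G) : Prop :=
  forall (g : G) (x : K), exists y : K, i y = (g * i x * g^-1)%g.

(* The quotient G/K. By [quo_coord] the comorphism of the projection identifies
   k[G/K] with the algebra of the K-invariant elements of k[G]: this rules out
   purely inseparable quotients of G/K in positive characteristic. *)
Record quotient_group (k : closedFieldType) (K G : affine_group k)
    (i : group_morphism K G) := QuotientGroup {
  quo :> affine_group k;
  quo_proj : group_morphism G quo;
  quo_surj : forall q : quo, exists g : G, quo_proj g = q;
  quo_ker : forall g : G, quo_proj g = 1%g <-> exists x : K, i x = g;
  quo_coord : forall f : coord G, (forall g x, eval (g * i x)%g f = eval g f) ->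
    exists f' : coord quo, forall g, eval (quo_proj g) f' = eval g f
}.

(* A rational G-module: g . v = sum_j f_j(g) w_j for finitely many f_j in k[G]
   and vectors w_j, i.e. v |-> sum_j w_j (x) f_j is a comodule structure. *)
Definition rational_action (k : closedFieldType) (G : affine_group k)
    (V : lmodType k) (act : G -> V -> V) : Prop :=
  [/\ forall v, act 1%g v = v,
      forall g h v, act (g * h)%g v = act g (act h v),
      forall g, linear (act g) &
      forall v, exists (n : nat) (f : 'I_n -> coord G) (w : 'I_n -> V),
        forall g, act g v = \sum_j (eval g (f j) : k) *: w j].

(* The k-vector space underlying a module over a k-algebra s : k -> R. *)
Definition restrict_scalars (k R : pzRingType) (s : {rmorphism k -> R})
  (M : lmodType R) : Type := M.

Section RestrictScalars.
Variables (k R : pzRingType) (s : {rmorphism k -> R}) (M : lmodType R).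

HB.instance Definition _ := GRing.Zmodule.on (restrict_scalars s M).

Let scale (c : k) (m : restrict_scalars s M) : restrict_scalars s M :=
  s c *: (m : M).

Fact restrict_scalersA a b v : scale a (scale b v) = scale (a * b) v.
Proof. by rewrite /scale scalerA rmorphM. Qed.
Fact restrict_scale1r : left_id 1 scale.
Proof. by move=> v; rewrite /scale rmorph1 scale1r. Qed.
Fact restrict_scalerDr : right_distributive scale +%R.
Proof. by move=> a u v; rewrite /scale scalerDr. Qed.
Fact restrict_scalerDl v : {morph scale^~ v : a b / a + b}.
Proof. by move=> a b; rewrite /scale rmorphD scalerDl. Qed.

HB.instance Definition _ := GRing.Zmodule_isLmodule.Build k (restrict_scalars s M)
  restrict_scalersA restrict_scale1r restrict_scalerDr restrict_scalerDl.

Lemma restrict_scaleE (c : k) (m : restrict_scalars s M) :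
  c *: m = s c *: (m : M).
Proof. by []. Qed.

End RestrictScalars.

Lemma restrict_regularE (k R : pzRingType) (s : {rmorphism k -> R}) (c : k)
  (r : restrict_scalars s R^o) : c *: r = s c * (r : R).
Proof. by []. Qed.

(* A commutative k-algebra is given by its structure map k -> R, so that the
   zero algebra, which is not a [comAlgType], is included. *)
Record module_algebra (k : closedFieldType) (G : affine_group k) := ModuleAlgebra {
  alg :> comPzRingType;
  alg_scalar : {rmorphism k -> alg};
  alg_act : G -> alg -> alg;
  alg_rational :
    @rational_action k G (restrict_scalars alg_scalar alg^o) alg_act;
  alg_act1 : forall g, alg_act g 1 = 1;
  alg_actM : forall g r s, alg_act g (r * s) = alg_act g r * alg_act g s
}.

Record gr_module (k : closedFieldType) (G : affine_group k)
    (R : module_algebra G) := GRModule {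
  gr_mod :> lmodType R;
  gr_act : G -> gr_mod -> gr_mod;
  gr_rational :
    @rational_action k G (restrict_scalars (alg_scalar R) gr_mod) gr_act;
  gr_actZ : forall g (r : R) m, gr_act g (r *: m) = alg_act g r *: gr_act g m
}.

Definition equivariant (k : closedFieldType) (G : affine_group k)
    (R : module_algebra G) (M N : gr_module R) (f : M -> N) : Prop :=
  forall g m, f (gr_act g m) = gr_act g (f m).

Record stable_ideal (k : closedFieldType) (G : affine_group k)
    (R : module_algebra G) := StableIdeal {
  ideal_pred : {pred R};
  ideal0 : 0 \in ideal_pred;
  idealB : {in ideal_pred &, forall u v, u - v \in ideal_pred};
  idealM : forall r, {in ideal_pred, forall u, r * u \in ideal_pred};
  ideal_stable : forall g, {in ideal_pred, forall u, alg_act g u \in ideal_pred}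
}.

Section AlgebraAction.
Variables (k : closedFieldType) (G : affine_group k) (R : module_algebra G).
Implicit Types (g h : G) (r s : R).

Lemma alg_act_id r : alg_act 1%g r = r.
Proof. by case: (alg_rational R). Qed.

Lemma alg_actMg g h r : alg_act (g * h)%g r = alg_act g (alg_act h r).
Proof. by case: (alg_rational R). Qed.

Lemma alg_actZD g (c : k) r s :
  alg_act g (alg_scalar R c * r + s) = alg_scalar R c * alg_act g r + alg_act g s.
Proof. by case: (alg_rational R) => _ _ /(_ g c r s). Qed.

Lemma alg_actD g r s : alg_act g (r + s) = alg_act g r + alg_act g s.
Proof. by have := alg_actZD g 1 r s; rewrite rmorph1 !mul1r. Qed.

Lemma alg_act0 g : alg_act g (0 : R) = 0.
Proof. by apply: (@addrI _ (alg_act g 0)); rewrite -alg_actD !addr0. Qed.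

Lemma alg_actB g r s : alg_act g (r - s) = alg_act g r - alg_act g s.
Proof. by apply: (@addIr _ (alg_act g s)); rewrite -alg_actD !subrK. Qed.

Lemma alg_act_scalar g c : alg_act g (alg_scalar R c) = alg_scalar R c.
Proof.
by have := alg_actZD g c 1 0; rewrite alg_act0 alg_act1 !addr0 mulr1.
Qed.

Lemma alg_act_sum g n (w : 'I_n -> R) :
  alg_act g (\sum_j w j) = \sum_j alg_act g (w j).
Proof.
apply: (big_morph (alg_act g)); [exact: alg_actD | exact: alg_act0].
Qed.

Lemma alg_rat r : exists (n : nat) (f : 'I_n -> coord G) (w : 'I_n -> R),
  forall g, alg_act g r = \sum_j alg_scalar R (eval g (f j)) * w j.
Proof. by case: (alg_rational R) => _ _ _ /(_ r). Qed.

End AlgebraAction.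

Section QuotientModule.
Variables (k : closedFieldType) (G : affine_group k) (R : module_algebra G).
Variable J : stable_ideal R.

Fact ideal_zmod_closed : zmod_closed (ideal_pred J).
Proof. by split; [exact: ideal0 | exact: idealB]. Qed.

HB.instance Definition _ := GRing.isZmodClosed.Build R (ideal_pred J)
  ideal_zmod_closed.

Definition ideal_quot : Type := {quot (ideal_pred J)}.
HB.instance Definition _ := GRing.Zmodule.on ideal_quot.

Definition ideal_class (r : R) : ideal_quot := \pi_({quot (ideal_pred J)}) r.

Lemma ideal_classP r s : ideal_class r = ideal_class s <-> r - s \in ideal_pred J.
Proof. by rewrite idealrBE; split=> [/eqP | /eqP]. Qed.

Lemma ideal_classD r s : ideal_class (r + s) = ideal_class r + ideal_class s.
Proof. exact: pi_addr. Qed.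

Lemma ideal_class_ex (y : ideal_quot) : exists r, y = ideal_class r.
Proof. by exists (repr y); rewrite /ideal_class reprK. Qed.

Let scale (r : R) (y : ideal_quot) : ideal_quot := ideal_class (r * repr y).

Let act (g : G) (y : ideal_quot) : ideal_quot := ideal_class (alg_act g (repr y)).

Lemma repr_class r : repr (ideal_class r) - r \in ideal_pred J.
Proof. by apply/ideal_classP; rewrite /ideal_class reprK. Qed.

Let scaleE r s : scale r (ideal_class s) = ideal_class (r * s).
Proof. by apply/ideal_classP; rewrite -mulrBr idealM ?repr_class. Qed.

Let actE g s : act g (ideal_class s) = ideal_class (alg_act g s).
Proof. by apply/ideal_classP; rewrite -alg_actB ideal_stable ?repr_class. Qed.

Fact ideal_quot_scalerA r s v : scale r (scale s v) = scale (r * s) v.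
Proof. by have [x ->] := ideal_class_ex v; rewrite !scaleE mulrA. Qed.
Fact ideal_quot_scale1r : left_id 1 scale.
Proof. by move=> v; have [x ->] := ideal_class_ex v; rewrite scaleE mul1r. Qed.
Fact ideal_quot_scalerDr : right_distributive scale +%R.
Proof.
move=> a u v; have [x ->] := ideal_class_ex u; have [y ->] := ideal_class_ex v.
by rewrite -ideal_classD !scaleE -ideal_classD mulrDr.
Qed.
Fact ideal_quot_scalerDl v : {morph scale^~ v : a b / a + b}.
Proof.
move=> a b; have [x ->] := ideal_class_ex v.
by rewrite !scaleE -ideal_classD mulrDl.
Qed.

HB.instance Definition _ := GRing.Zmodule_isLmodule.Build R ideal_quot
  ideal_quot_scalerA ideal_quot_scale1r ideal_quot_scalerDr ideal_quot_scalerDl.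

Definition ideal_quot_act : G -> ideal_quot -> ideal_quot := act.

Lemma ideal_quot_scaleE r s : r *: ideal_class s = ideal_class (r * s).
Proof. exact: scaleE. Qed.

Lemma ideal_quot_actE g s :
  ideal_quot_act g (ideal_class s) = ideal_class (alg_act g s).
Proof. exact: actE. Qed.

Lemma ideal_class_sum n (w : 'I_n -> R) :
  ideal_class (\sum_j w j) = \sum_j ideal_class (w j).
Proof.
apply: (big_morph ideal_class); [exact: ideal_classD | exact: pi_zeror].
Qed.

Fact ideal_quot_rational :
  @rational_action k G (restrict_scalars (alg_scalar R) ideal_quot)
    ideal_quot_act.
Proof.
split=> [v|g h v|g c u v|v].
- by have [x ->] := ideal_class_ex v; rewrite ideal_quot_actE alg_act_id.
- by have [x ->] := ideal_class_ex v; rewrite !ideal_quot_actE alg_actMg.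
- have [x ->] := ideal_class_ex u; have [y ->] := ideal_class_ex v.
  rewrite !restrict_scaleE ideal_quot_actE ideal_quot_scaleE -ideal_classD.
  by rewrite !ideal_quot_actE alg_actZD ideal_classD -ideal_quot_scaleE.
- have [x ->] := ideal_class_ex v; have [n [f [w fw]]] := alg_rat x.
  exists n, f, (fun j => ideal_class (w j)) => g.
  rewrite ideal_quot_actE fw ideal_class_sum; apply: eq_bigr => j _.
  by rewrite restrict_scaleE ideal_quot_scaleE.
Qed.

Fact ideal_quot_actZ g (r : R) m :
  ideal_quot_act g (r *: m) = alg_act g r *: ideal_quot_act g m.
Proof.
have [x ->] := ideal_class_ex m.
by rewrite ideal_quot_scaleE !ideal_quot_actE ideal_quot_scaleE alg_actM.
Qed.

Definition quotient_module : gr_module R :=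
  GRModule ideal_quot_rational ideal_quot_actZ.

End QuotientModule.

Definition linearly_reductive (k : closedFieldType) (G : affine_group k)
    (R : module_algebra G) : Prop :=
  forall (M : gr_module R) (J : stable_ideal R)
         (lambda : {linear M -> quotient_module J}),
    equivariant lambda ->
    (forall y, exists m, lambda m = y) ->
    exists m : M, (forall g, gr_act g m = m) /\ lambda m = ideal_class J 1.

Lemma gmor1 (k : closedFieldType) (H G : affine_group k)
  (i : group_morphism H G) : i 1%g = 1%g.
Proof. by apply: (@mulgI _ (i 1%g)); rewrite -gmorM !mulg1. Qed.

Lemma gmorV (k : closedFieldType) (H G : affine_group k)
  (i : group_morphism H G) x : i x^-1%g = (i x)^-1%g.
Proof. by apply: (@mulgI _ (i x)); rewrite -gmorM !mulgV gmor1. Qed.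

Section Restriction.
Variables (k : closedFieldType) (K G : affine_group k).
Variables (i : group_morphism K G) (R : module_algebra G).

Let act (x : K) (r : R) : R := alg_act (i x) r.

Fact restrict_rational :
  @rational_action k K (restrict_scalars (alg_scalar R) R^o) act.
Proof.
split=> [v|g h v|g c u v|v]; rewrite /act.
- by rewrite gmor1 alg_act_id.
- by rewrite gmorM alg_actMg.
- exact: alg_actZD.
- have [n [f [w fw]]] := alg_rat v.
  have [f' f'E] := choice (fun j => gmor_regular i (f j)).
  exists n, f', w => x; rewrite fw; apply: eq_bigr => j _.
  by rewrite f'E.
Qed.

Definition restrict_algebra : module_algebra K :=
  ModuleAlgebra restrict_rational (fun x => alg_act1 R (i x))
    (fun x => alg_actM (i x)).

End Restriction.

Section Translation.
Variables (k : closedFieldType) (G : affine_group k).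

Lemma eval_ext (f f' : coord G) : (forall g, eval g f = eval g f') -> f = f'.
Proof.
move=> ff'; apply/eqP; rewrite -subr_eq0; apply/eqP/eval_inj => g.
by rewrite linearB /= ff' subrr.
Qed.

Fact translation_ex (h : G) (f : coord G) :
  {f' : coord G | forall g, eval g f' = eval (g * h)%g f}.
Proof.
apply/cid; have [n [a [b ab]]] := coord_mul f.
exists (\sum_j (eval h (b j) : k) *: a j) => g.
rewrite ab linear_sum; apply: eq_bigr => j _.
by rewrite linearZ /= [RHS]mulrC.
Qed.

Definition translate (h : G) (f : coord G) : coord G := sval (translation_ex h f).

Lemma translateE h f g : eval g (translate h f) = eval (g * h)%g f.
Proof. exact: (svalP (translation_ex h f)). Qed.

Fact translate_rational :
  @rational_action k G (restrict_scalars (GRing.in_alg (coord G)) (coord G)^o)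
    translate.
Proof.
split=> [v|g h v|g c u v|v].
- by apply: eval_ext => x; rewrite translateE mulg1.
- by apply: eval_ext => x; rewrite !translateE mulgA.
- apply: eval_ext => x; rewrite translateE !restrict_scaleE /=.
  rewrite /GRing.scale /= !mulr_algl.
  by rewrite !linearD !linearZ /= !translateE.
- have [n [a [b ab]]] := coord_mul v.
  exists n, b, a => h; apply: eval_ext => g.
  rewrite translateE ab linear_sum; apply: eq_bigr => j _.
  rewrite restrict_regularE mulr_algl.
  by rewrite linearZ /= [LHS]mulrC.
Qed.

Fact translate1 h : translate h 1 = 1.
Proof. by apply: eval_ext => g; rewrite translateE !rmorph1. Qed.

Fact translateM h u v : translate h (u * v) = translate h u * translate h v.
Proof. by apply: eval_ext => g; rewrite translateE !rmorphM /= !translateE. Qed.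

(* k[G] with the action (h . f)(g) = f(gh). *)
Definition translation_algebra : module_algebra G :=
  ModuleAlgebra translate_rational translate1 translateM.

End Translation.

Section FixedElements.
Variables (k : closedFieldType) (K : affine_group k) (R : module_algebra K).

Definition fixed_pred : {pred R} := fun r => `[< forall x : K, alg_act x r = r >].

Lemma fixedP r : reflect (forall x : K, alg_act x r = r) (r \in fixed_pred).
Proof. exact: asboolP. Qed.

Fact fixed_subring_closed : subring_closed fixed_pred.
Proof.
split.
- by apply/fixedP => x; exact: alg_act1.
- move=> u v /fixedP hu /fixedP hv; apply/fixedP => x.
  by rewrite alg_actB hu hv.
- move=> u v /fixedP hu /fixedP hv; apply/fixedP => x.
  by rewrite alg_actM hu hv.
Qed.

HB.instance Definition _ := GRing.isSubringClosed.Build R fixed_pred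
  fixed_subring_closed.

Definition fixed_ring : Type := {r : R | r \in fixed_pred}.
HB.instance Definition _ := SubChoice.on fixed_ring.
HB.instance Definition _ := GRing.SubChoice_isSubComPzRing.Build R fixed_pred fixed_ring
  fixed_subring_closed.

End FixedElements.

Arguments fixed_pred {k K} R _.

(* In an expression sum_j f_j(g) w_j both families can be taken independent;
   this shows below that the action of G/K on the K-fixed elements is rational. *)
Section Independence.
Variables (k : closedFieldType) (G : affine_group k).

Lemma evalZ (g : G) (a : k) (f : coord G) :
  eval g (a *: f) = a * (eval g f : k) :> k.
Proof. by rewrite linearZ. Qed.

Lemma evalB (g : G) (f f' : coord G) :
  eval g (f - f') = (eval g f : k) - (eval g f' : k) :> k.
Proof. by rewrite linearB. Qed.

Definition independent (V : lmodType k) n (v : 'I_n -> V) : Prop :=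
  forall c : 'I_n -> k, \sum_j c j *: v j = 0 -> forall j, c j = 0.

Lemma dependent_ex (V : lmodType k) n (v : 'I_n -> V) : ~ independent v ->
  exists (c : 'I_n -> k) j0, \sum_j c j *: v j = 0 /\ c j0 != 0.
Proof.
move=> /existsNP [c /not_implyP [c0 /existsNP [j /eqP cj]]].
by exists c, j.
Qed.

Lemma dependentE (V : lmodType k) n (v : 'I_n.+1 -> V) (c : 'I_n.+1 -> k) j0 :
  \sum_j c j *: v j = 0 -> c j0 != 0 ->
  v j0 = - \sum_(l < n) (c (lift j0 l) / c j0) *: v (lift j0 l).
Proof.
rewrite (bigD1_ord j0) //= => /eqP; rewrite addr_eq0 => /eqP cv c0.
rewrite -[LHS]scale1r -(mulVf c0) -scalerA cv scalerN scaler_sumr.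
by congr (- _); apply: eq_bigr => l _; rewrite scalerA mulrC.
Qed.

Lemma independent_expansion (V : lmodType k) (F : G -> V) n
    (f : 'I_n -> coord G) (w : 'I_n -> V) :
    (forall g, F g = \sum_j (eval g (f j) : k) *: w j) ->
  exists m (f' : 'I_m -> coord G) (w' : 'I_m -> V),
    [/\ forall g, F g = \sum_j (eval g (f' j) : k) *: w' j,
        independent f' & independent w'].
Proof.
elim: n f w => [|n IHn] f w Fw.
  by exists 0, f, w; split=> // c _ [].
have [fi|/dependent_ex [c [j0 [cf c0]]]] := pselect (independent f); last first.
  apply: (IHn (fun l => f (lift j0 l))
    (fun l => w (lift j0 l) - (c (lift j0 l) / c j0) *: w j0)) => g.
  rewrite Fw (bigD1_ord j0) //= {1}(dependentE cf c0) linearN linear_sum /=.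
  rewrite scaleNr scaler_suml -sumrN -big_split /=; apply: eq_bigr => l _.
  by rewrite evalZ scalerBr [LHS]addrC scalerA mulrC.
have [wi|/dependent_ex [c [j0 [cw c0]]]] := pselect (independent w).
  by exists n.+1, f, w; split.
apply: (IHn (fun l => f (lift j0 l) - (c (lift j0 l) / c j0) *: f j0)
  (fun l => w (lift j0 l))) => g.
rewrite Fw (bigD1_ord j0) //= (dependentE cw c0) scalerN scaler_sumr.
rewrite -sumrN -big_split /=; apply: eq_bigr => l _.
by rewrite evalB evalZ scalerBl [LHS]addrC scalerA mulrC.
Qed.

Lemma independent_coeffs (V : lmodType k) n (f : 'I_n -> coord G)
    (u : 'I_n -> V) : independent f ->
  (forall g, \sum_j (eval g (f j) : k) *: u j = 0) -> forall j, u j = 0.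
Proof.
elim: n f u => [|n IHn] f u fi fu; first by case.
have [g0 g0f] : exists g, (eval g (f ord0) : k) != 0.
  apply: contrapT => /forallNP hg.
  have f0 : f ord0 = 0.
    by apply: eval_inj => g; apply: contrapT => /eqP /hg.
  have /(_ _ ord0) := fi (fun j => (j == ord0)%:R).
  rewrite (bigD1_ord ord0) //= f0 scaler0 add0r big1; last first.
    by move=> l _; rewrite scale0r.
  by move=> /(_ erefl) /eqP; rewrite oner_eq0.
pose b l : k := (eval g0 (f (lift ord0 l)) : k) / (eval g0 (f ord0) : k).
have u0 : u ord0 = - \sum_(l < n) b l *: u (lift ord0 l).
  exact: (dependentE (c := fun j => eval g0 (f j))).
have ul l : u (lift ord0 l) = 0.
  move: l; apply: (IHn (fun l => f (lift ord0 l) - b l *: f ord0)).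
    move=> c cf l.
    pose c' j : k := if unlift ord0 j is Some l then c l
                     else - \sum_(l < n) c l * b l.
    have -> : c l = c' (lift ord0 l) by rewrite /c' liftK.
    apply: fi; rewrite (bigD1_ord ord0) //= {1}/c' unlift_none -[RHS]cf.
    rewrite scaleNr scaler_suml -sumrN -big_split /=; apply: eq_bigr => m _.
    by rewrite /c' liftK scalerBr [LHS]addrC scalerA.
  move=> g; rewrite -[RHS](fu g) (bigD1_ord ord0) //= u0 scalerN scaler_sumr.
  rewrite -sumrN -big_split /=; apply: eq_bigr => l _.
  by rewrite evalB evalZ scalerBl [RHS]addrC scalerA mulrC.
move=> j; case: (unliftP ord0 j) => [l|] -> //.
by rewrite u0 big1 ?oppr0 // => l _; rewrite ul scaler0.
Qed.

End Independence.

Section QuotientAction.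
Variables (k : closedFieldType) (K G : affine_group k) (i : group_morphism K G).
Variables (Q : quotient_group i) (R : module_algebra G).

Local Notation RK := (fixed_ring (restrict_algebra i R)).

Lemma fixed_actE (r : RK) (x : K) : alg_act (i x) (val r : R) = val r.
Proof. by have /fixedP := valP r; apply. Qed.

Lemma quo_fiber (g h : G) : quo_proj Q g = quo_proj Q h ->
  exists x : K, g = (h * i x)%g.
Proof.
move=> gh; have [|x xE] := (quo_ker Q (h^-1 * g)%g).1.
  by rewrite gmorM gmorV gh mulVg.
by exists x; rewrite xE mulgA mulgV mul1g.
Qed.

Lemma quo_conj (g : G) (x : K) : exists y : K, (i x * g)%g = (g * i y)%g.
Proof.
apply: quo_fiber; rewrite gmorM.
by have -> : quo_proj Q (i x) = 1%g by [apply/quo_ker; exists x]; rewrite mul1g.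
Qed.

Lemma act_fixed (g : G) (r : RK) :
  alg_act g (val r : R) \in fixed_pred (restrict_algebra i R).
Proof.
apply/fixedP => x; rewrite /= -alg_actMg.
by have [y ->] := quo_conj g x; rewrite alg_actMg fixed_actE.
Qed.

Fact quo_lift_ex (q : Q) : exists g : G, quo_proj Q g == q.
Proof. by have [g <-] := quo_surj q; exists g. Qed.

Definition quo_lift (q : Q) : G := xchoose (quo_lift_ex q).

Lemma quo_liftK q : quo_proj Q (quo_lift q) = q.
Proof. exact/eqP/(xchooseP (quo_lift_ex q)). Qed.

(* q . r := g . r for any g in the coset q. *)
Definition fixed_act (q : Q) (r : RK) : RK :=
  exist _ (alg_act (quo_lift q) (val r : R)) (act_fixed (quo_lift q) r).

Lemma fixed_act_proj (g : G) (r : RK) :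
  val (fixed_act (quo_proj Q g) r) = alg_act g (val r : R).
Proof.
have [x xE] := quo_fiber (quo_liftK (quo_proj Q g)).
by rewrite /= xE alg_actMg fixed_actE.
Qed.

Fact fixed_scalar_subproof (c : k) :
  alg_scalar R c \in fixed_pred (restrict_algebra i R).
Proof. by apply/fixedP => x; rewrite /= alg_act_scalar. Qed.

Definition fixed_scalar (c : k) : RK :=
  exist _ (alg_scalar R c : restrict_algebra i R) (fixed_scalar_subproof c).

Fact fixed_scalar_zmod : zmod_morphism fixed_scalar.
Proof. by move=> a b; apply/val_inj; rewrite /= rmorphB. Qed.
Fact fixed_scalar_monoid : monoid_morphism fixed_scalar.
Proof.
by split=> [|a b]; apply/val_inj; rewrite /= ?rmorph1 ?rmorphM.
Qed.

HB.instance Definition _ := GRing.isZmodMorphism.Build k RK fixed_scalar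
  fixed_scalar_zmod.
HB.instance Definition _ := GRing.isMonoidMorphism.Build k RK fixed_scalar
  fixed_scalar_monoid.

Fact fixed_rational :
  @rational_action k Q (restrict_scalars fixed_scalar RK^o) fixed_act.
Proof.
split=> [v|q q' v|q c u v|v].
- apply/val_inj; rewrite -(gmor1 (quo_proj Q)) fixed_act_proj.
  exact: (alg_act_id (val v : R)).
- apply/val_inj; have [g <-] := quo_surj q; have [h <-] := quo_surj q'.
  by rewrite -gmorM !fixed_act_proj alg_actMg.
- apply/val_inj; have [g <-] := quo_surj q.
  rewrite fixed_act_proj; have := alg_actZD g c (val u : R) (val v : R).
  by rewrite -!fixed_act_proj.
- have [n [f [w fw]]] := alg_rat (val v : R).
  have [m [f' [w' [Fw fi wi]]]] := @independent_expansion _ _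
    (restrict_scalars (alg_scalar R) R^o) (fun g => alg_act g (val v : R)) _ f w fw.
  have wK j : (w' j : R) \in fixed_pred (restrict_algebra i R).
    apply/fixedP => x; apply/eqP; rewrite -subr_eq0; apply/eqP.
    apply: (independent_coeffs (V := restrict_scalars (alg_scalar R) R^o)
      (u := fun j => (alg_act (i x) (w' j : R) - w' j : R)) fi) => g.
    under eq_bigr do rewrite scalerBr.
    rewrite sumrB -Fw; apply/eqP; rewrite subr_eq0; apply/eqP.
    have [y yE] := quo_conj g x.
    rewrite -[in RHS](fixed_actE v y) -alg_actMg -yE alg_actMg Fw alg_act_sum.
    apply: eq_bigr => l _.
    by rewrite !restrict_regularE alg_actM alg_act_scalar.
  have fK j g x : (eval (g * i x)%g (f' j) : k) = eval g (f' j).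
    apply/eqP; rewrite -subr_eq0; apply/eqP.
    apply: (wi (fun j => (eval (g * i x)%g (f' j) : k) - (eval g (f' j) : k))).
    under eq_bigr do rewrite scalerBl.
    by rewrite sumrB -!Fw alg_actMg fixed_actE subrr.
  have [f'' f''E] := choice (fun j => quo_coord Q (fK j)).
  exists m, f'', (fun j => exist _ (w' j : restrict_algebra i R) (wK j)) => q.
  have [g <-] := quo_surj q; apply/val_inj.
  rewrite fixed_act_proj Fw (raddf_sum (val : RK -> R)).
  by apply: eq_bigr => j _; rewrite f''E.
Qed.

Fact fixed_act1 q : fixed_act q 1 = 1.
Proof. by apply/val_inj; rewrite /= alg_act1. Qed.

Fact fixed_actM q r s : fixed_act q (r * s) = fixed_act q r * fixed_act q s.
Proof. by apply/val_inj; rewrite /= alg_actM. Qed.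

Definition fixed_algebra : module_algebra Q :=
  ModuleAlgebra fixed_rational fixed_act1 fixed_actM.

End QuotientAction.

(* Main.v *)
(* Say that [R] has integrals when every finite-dimensional representation [V] of
   [G] with a fixed vector [c != 0] has an equivariant linear map [V -> R] sending
   [c] to 1 (a finite-dimensional form of Doi's total integrals [k[G] -> R]). This
   is equivalent to linear reductivity: one way, apply the definition to the
   (G,R)-module [Hom(V, R)] and to the evaluation at [c]; the other way, integrate
   the orbit map [g |-> g^-1 m] of a preimage [m] of 1. Part (1) is then the
   composition of [V -> k[G]] with [W -> R], for [W] a finite-dimensional stable
   subspace of [k[G]]. For part (2) one needs that [k[G]] has integrals for a
   normal [K]. A quotient of finite-dimensional subspaces of [k[G]] maps to [k[G]]
   up to a character of [K], by determinants of values at translates; since [K] is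
   normal, the inverse character is the weight of some function as well. This
   gives an equivariant [V -> k[G]] that does not kill [c]; the image of [c]
   and its left translates generate the unit ideal of the K-invariant functions.
   Conversely, if [K] and [G/K] are linearly reductive on [R] and [R^K], an
   equivariant map for [K] is averaged over [G/K]. *)

From HB Require Import structures.
From mathcomp Require Import all_boot all_order all_algebra.
From mathcomp Require Import boolp.
Require Import Defs.

Set Implicit Arguments.
Unset Strict Implicit.
Unset Printing Implicit Defensive.

Import GRing.Theory.
Local Open Scope ring_scope.

(** * Spans of finite families and independence *)

Section Span.
Variables (k : closedFieldType) (V : lmodType k).

Definition in_span (I : finType) (w : I -> V) (v : V) : Prop :=
  exists c : I -> k, v = \sum_j c j *: w j.

Lemma in_span_mem (I : finType) (w : I -> V) i : in_span w (w i).
Proof.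
exists (fun j => (j == i)%:R); rewrite (bigD1 i) //= eqxx scale1r big1 ?addr0 //.
by move=> j /negPf ->; rewrite scale0r.
Qed.

Lemma in_span_sum (I J : finType) (w : I -> V) (c : J -> k) (v : J -> V) :
  (forall j, in_span w (v j)) -> in_span w (\sum_j c j *: v j).
Proof.
move=> /choice [d dE]; exists (fun i => \sum_j c j * d j i).
under eq_bigr => j _ do rewrite dE scaler_sumr.
rewrite exchange_big /=; apply: eq_bigr => i _; rewrite scaler_suml.
by apply: eq_bigr => j _; rewrite scalerA.
Qed.

Lemma in_spanB (I : finType) (w : I -> V) u v :
  in_span w u -> in_span w v -> in_span w (u - v).
Proof.
move=> [c ->] [d ->]; exists (fun j => c j - d j).
by rewrite -sumrB; apply: eq_bigr => j _; rewrite scalerBl.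
Qed.

Lemma independent_inj n (v : 'I_n -> V) (c d : 'I_n -> k) : independent v ->
  \sum_j c j *: v j = \sum_j d j *: v j -> c =1 d.
Proof.
move=> vi cd j; apply/eqP; rewrite -subr_eq0; apply/eqP.
apply: (vi (fun j => c j - d j)); under eq_bigr do rewrite scalerBl.
by rewrite sumrB cd subrr.
Qed.

Lemma independent_leq (I : finType) (w : I -> V) m (v : 'I_m -> V) :
  independent v -> (forall i, in_span w (v i)) -> (m <= #|I|)%N.
Proof.
move=> vi /choice [c cE].
pose C := \matrix_(i < m, j < #|I|) c i (enum_val j).
suff /eqP <- : row_free C by exact: rank_leq_col.
apply: inj_row_free => u uC; apply/rowP => i; rewrite mxE.
apply: (vi (fun i => u 0 i)); under eq_bigr => l _ do rewrite cE scaler_sumr.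
rewrite exchange_big /= big1 // => j _.
transitivity ((u *m C) 0 (enum_rank j) *: w j); last by rewrite uC mxE scale0r.
rewrite mxE scaler_suml; apply: eq_bigr => l _.
by rewrite mxE enum_rankK scalerA.
Qed.

Lemma independent_rcons n (v : 'I_n.+1 -> V) u : independent v ->
  ~ in_span v u ->
  independent (fun j => if unlift ord_max j is Some l then v l else u).
Proof.
move=> vi vu c; rewrite big_ord_recr /= unlift_none => cv.
have lE (l : 'I_n.+1) : unlift ord_max (widen_ord (leqnSn n.+1) l) = Some l.
  have -> : widen_ord (leqnSn n.+1) l = lift ord_max l.
    by apply: val_inj; rewrite /= /bump leqNgt ltn_ord.
  by rewrite liftK.
have c0 : c ord_max = 0.
  apply: contrapT => /eqP c0; apply: vu.
  exists (fun l => - (c (widen_ord (leqnSn n.+1) l) / c ord_max)).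
  move/eqP: cv; rewrite addrC addr_eq0 => /eqP cv.
  rewrite -[LHS]scale1r -(mulVf c0) -scalerA cv scalerN scaler_sumr -sumrN.
  by apply: eq_bigr => l _; rewrite lE scalerA scaleNr mulrC.
move: cv; rewrite c0 scale0r addr0 => cv j.
case: (unliftP ord_max j) => [l ->|-> //].
have -> : lift ord_max l = widen_ord (leqnSn n.+1) l.
  by apply: val_inj; rewrite /= /bump leqNgt ltn_ord.
apply: (vi (fun l => c (widen_ord (leqnSn n.+1) l))).
by rewrite -[RHS]cv; apply: eq_bigr => m _; rewrite lE.
Qed.

(** A longest independent family in [P] starting with [v0] spans [P], and lengths are bounded by
    [#|I|]. As [P] need not be a subspace, bases can be chosen among translates or characters. *)
Lemma max_independent (I : finType) (w : I -> V) (P : V -> Prop) v0 :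
    (forall v, P v -> in_span w v) -> P v0 -> v0 != 0 ->
  exists m (v : 'I_m.+1 -> V), [/\ v ord0 = v0, forall i, P (v i),
    independent v & forall u, P u -> in_span v u].
Proof.
move=> Pw Pv0 v0n0.
pose S m := `[< exists v : 'I_m.+1 -> V,
  [/\ v ord0 = v0, forall i, P (v i) & independent v] >].
have exS : exists m, S m.
  exists 0%N; apply/asboolP; exists (fun=> v0); split=> // c.
  rewrite big_ord1 => /eqP; rewrite scaler_eq0 (negPf v0n0) orbF => /eqP c0 j.
  by rewrite ord1.
have ubS m : S m -> (m <= #|I|)%N.
  move=> /asboolP [v [_ Pv vi]]; apply/ltnW.
  by apply: (independent_leq vi) => i; exact/Pw/Pv.
have [m /asboolP [v [vE Pv vi]] mmax] := ex_maxnP exS ubS.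
exists m, v; split=> // u Pu; apply: contrapT => vu.
have /mmax : S m.+1; last by rewrite ltnn.
apply/asboolP.
exists (fun j => if unlift ord_max j is Some l then v l else u); split.
- have -> : ord0 = lift ord_max ord0 :> 'I_m.+2 by apply: val_inj.
  by rewrite liftK.
- by move=> i; case: unlift.
- exact: independent_rcons.
Qed.

End Span.

(** * Evaluation of functions at points of the group *)

Section Evaluation.
Variables (k : closedFieldType) (G : affine_group k).

(* [eval g] with its values in the field [k] rather than in the algebra [k^o]. *)
Definition ev (g : G) (f : coord G) : k := eval g f.

Fact ev_zmod g : zmod_morphism (ev g).
Proof. by move=> f f'; rewrite /ev linearB. Qed.
Fact ev_monoid g : monoid_morphism (ev g).
Proof. by split=> [|f f']; rewrite /ev ?rmorph1 ?rmorphM. Qed.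

HB.instance Definition _ g :=
  GRing.isZmodMorphism.Build (coord G) k (ev g) (ev_zmod g).
HB.instance Definition _ g :=
  GRing.isMonoidMorphism.Build (coord G) k (ev g) (ev_monoid g).

Lemma evZ g (a : k) f : ev g (a *: f) = a * ev g f.
Proof. exact: evalZ. Qed.

Lemma ev_comb (I : finType) g (c : I -> k) (v : I -> coord G) :
  ev g (\sum_j c j *: v j) = \sum_j c j * ev g (v j).
Proof. by rewrite rmorph_sum; apply: eq_bigr => j _ /=; rewrite evZ. Qed.

Lemma ev_ext (f f' : coord G) : (forall g, ev g f = ev g f') -> f = f'.
Proof. exact: eval_ext. Qed.

Lemma ev_mul f : exists (n : nat) (a b : 'I_n -> coord G), forall g h,
  ev (g * h)%g f = \sum_j ev g (a j) * ev h (b j).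
Proof. exact: coord_mul. Qed.

Lemma ev_translate h f g : ev g (translate h f) = ev (g * h)%g f.
Proof. exact: translateE. Qed.

Lemma in_span_translate (I : finType) (b : I -> coord G) h u :
  (forall j, in_span b (translate h (b j))) -> in_span b u ->
  in_span b (translate h u).
Proof.
move=> bh [c ->]; have -> : translate h (\sum_j c j *: b j) =
    \sum_j c j *: translate h (b j).
  apply: ev_ext => g; rewrite ev_translate !ev_comb.
  by apply: eq_bigr => j _; rewrite ev_translate.
exact: in_span_sum.
Qed.

Lemma ev_independent_coeffs (V : lmodType k) n (f : 'I_n -> coord G)
    (u v : 'I_n -> V) : independent f ->
  (forall g, \sum_j ev g (f j) *: u j = \sum_j ev g (f j) *: v j) -> u =1 v.
Proof.
move=> fi uv j; apply/eqP; rewrite -subr_eq0; apply/eqP.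
apply: (independent_coeffs (u := fun j => u j - v j) fi) => g.
under eq_bigr do rewrite scalerBr.
by rewrite sumrB; apply/eqP; rewrite subr_eq0; apply/eqP/uv.
Qed.

End Evaluation.

(** * Points separating independent functions *)

Section Points.
Variables (k : closedFieldType) (G : affine_group k).

(** Induction on [n]: if the determinant vanished for every new point [h], its expansion along the
    row of [h] would be a linear relation between the [v j], with a nonzero coefficient by
    induction. *)
Lemma independent_points n (v : 'I_n -> coord G) : independent v ->
  exists g : 'I_n -> G, (\matrix_(l, j) ev (g l) (v j)) \in unitmx.
Proof.
elim: n v => [|n IHn] v vi.
  by exists (fun=> 1%g); rewrite unitmxE det_mx00 unitr1.
have /IHn [g gu] : independent (fun j => v (lift ord0 j)).
  move=> c cv j; pose d i := if unlift ord0 i is Some l then c l else 0.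
  have <- : d (lift ord0 j) = c j by rewrite /d liftK.
  apply: vi; rewrite (bigD1_ord ord0) //= {1}/d unlift_none scale0r add0r -[RHS]cv.
  by apply: eq_bigr => l _; rewrite /d liftK.
pose M h := \matrix_(l, j)
  ev (if unlift ord0 l is Some l' then g l' else h) (v j) : 'M_n.+1.
have cofE h h' j : cofactor (M h) ord0 j = cofactor (M h') ord0 j.
  rewrite /cofactor; congr (_ * \det _); apply/matrixP => a b.
  by rewrite !mxE !liftK.
have [h hn0] : exists h, \det (M h) != 0.
  apply: contrapT => /forallNP h0.
  have : cofactor (M 1%g) ord0 ord0 = 0.
    move: (ord0 in X in cofactor _ _ X); apply: vi; apply: ev_ext => h.
    have /negP/negPn/eqP dM := h0 h.
    rewrite ev_comb rmorph0 -[RHS]dM (expand_det_row _ ord0).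
    by apply: eq_bigr => j _; rewrite (cofE 1%g h) [RHS]mulrC mxE unlift_none.
  rewrite /cofactor expr0 mul1r => d0; move: gu; rewrite unitmxE unitfE.
  suff -> : (\matrix_(l, j) ev (g l) (v (lift ord0 j))) =
    row' ord0 (col' ord0 (M 1%g)) by rewrite d0 eqxx.
  by apply/matrixP => a b; rewrite !mxE liftK.
exists (fun l => if unlift ord0 l is Some l' then g l' else h).
by rewrite unitmxE unitfE.
Qed.

(** By the inverse matrix, coordinates with respect to [v] are combinations of evaluations at
    points; this is how coefficients are shown to be regular functions. *)
Lemma dual_points n (v : 'I_n -> coord G) : independent v ->
  exists (g : 'I_n -> G) (C : 'M[k]_n), forall i j,
    \sum_l C i l * ev (g l) (v j) = (i == j)%:R.
Proof.
move=> /independent_points [g]; set E := \matrix_(l, j) _ => gu.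
exists g, (invmx E) => i j; have := congr1 (fun M : 'M_n => M i j) (mulVmx gu).
by rewrite !mxE => <-; apply: eq_bigr => l _; rewrite [in RHS]mxE.
Qed.

End Points.

(** * Regular maps, matrix representations and stable subspaces of [coord G] *)

Section Regular.
Variables (k : closedFieldType) (G : affine_group k).

Definition regular_map (V : lmodType k) (F : G -> V) : Prop :=
  exists (n : nat) (f : 'I_n -> coord G) (w : 'I_n -> V),
    forall g, F g = \sum_j ev g (f j) *: w j.

Lemma regular_map_fin (V : lmodType k) (F : G -> V) (I : finType)
    (f : I -> coord G) (w : I -> V) :
  (forall g, F g = \sum_j ev g (f j) *: w j) -> regular_map F.
Proof.
move=> FE; exists #|I|, (fun j => f (enum_val j)), (fun j => w (enum_val j)) => g.
by rewrite FE (reindex _ (onW_bij _ (@enum_val_bij I))).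
Qed.

Lemma regular_map_sum (V : lmodType k) (I : finType) (F : I -> G -> V) :
  (forall i, regular_map (F i)) -> regular_map (fun g => \sum_i F i g).
Proof.
move=> /fin_all_exists [n /fin_all_exists [f /fin_all_exists [w wE]]].
apply: (@regular_map_fin _ _ {i : I & 'I_(n i)}
  (fun u => f (tag u) (tagged u)) (fun u => w (tag u) (tagged u))) => g.
rewrite -(@sig_big_dep _ _ _ _ (fun i => 'I_(n i)) xpredT (fun=> xpredT)
  (fun i j => ev g (f i j) *: w i j)) /=.
by apply: eq_bigr => i _; rewrite wE.
Qed.

Lemma regular_map_scale (V : lmodType k) (f : coord G) (F : G -> V) :
  regular_map F -> regular_map (fun g => ev g f *: F g).
Proof.
move=> [n [f' [w FE]]]; exists n, (fun j => f * f' j), w => g.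
by rewrite FE scaler_sumr; apply: eq_bigr => j _; rewrite scalerA rmorphM.
Qed.

Definition regular_mx m n (A : G -> 'M[k]_(m, n)) : Prop :=
  forall i j, exists f, forall g, ev g f = A g i j.

Definition matrix_rep n (A : G -> 'M[k]_n) : Prop :=
  [/\ A 1%g = 1%:M, forall g h, A (g * h)%g = A g *m A h & regular_mx A].

Lemma matrix_repK n (A : G -> 'M[k]_n) g : matrix_rep A -> A g *m A g^-1%g = 1%:M.
Proof. by move=> [A1 AM _]; rewrite -AM mulgV. Qed.

Lemma matrix_repVK n (A : G -> 'M[k]_n) g : matrix_rep A -> A g^-1%g *m A g = 1%:M.
Proof. by move=> [A1 AM _]; rewrite -AM mulVg. Qed.

Fact ltranslate_ex (h : G) (f : coord G) :
  {f' : coord G | forall g, ev g f' = ev (h * g)%g f}.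
Proof.
apply/cid; have [n [a [b ab]]] := ev_mul f.
by exists (\sum_j ev h (a j) *: b j) => g; rewrite ab ev_comb.
Qed.

Definition ltranslate (h : G) (f : coord G) : coord G := sval (ltranslate_ex h f).

Lemma ev_ltranslate h f g : ev g (ltranslate h f) = ev (h * g)%g f.
Proof. exact: (svalP (ltranslate_ex h f)). Qed.

Fact coinverse_ex (f : coord G) : {f' : coord G | forall g, ev g f' = ev g^-1%g f}.
Proof. exact/cid/coord_inv. Qed.

Definition coinverse (f : coord G) : coord G := sval (coinverse_ex f).

Lemma ev_coinverse f g : ev g (coinverse f) = ev g^-1%g f.
Proof. exact: (svalP (coinverse_ex f)). Qed.

Lemma regular_mapV (V : lmodType k) (F : G -> V) :
  regular_map F -> regular_map (fun g => F g^-1%g).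
Proof.
move=> [n [f [w FE]]]; exists n, (fun j => coinverse (f j)), w => g.
by rewrite FE; apply: eq_bigr => j _; rewrite ev_coinverse.
Qed.

Lemma regular_ltranslate f : regular_map (fun g => ltranslate g f).
Proof.
have [n [a [b ab]]] := ev_mul f; exists n, a, b => g.
by apply: ev_ext => h; rewrite ev_ltranslate ab ev_comb.
Qed.

(** By [ev_mul], the right translates of the [f j] span a finite-dimensional space. [A] is the
    matrix of right translation on its sum with the constants; 1 comes first in the basis, so that
    [delta_mx ord0 0] is a fixed vector. *)
Lemma stable_span n (f : 'I_n -> coord G) :
  exists m (b : 'I_m.+1 -> coord G) (A : G -> 'M[k]_m.+1),
    [/\ b ord0 = 1, independent b, forall j, in_span b (f j),
        forall g h i, ev (g * h)%g (b i) = \sum_l ev g (b l) * A h l i &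
        matrix_rep A /\ forall g, col ord0 (A g) = delta_mx ord0 0].
Proof.
have [N /fin_all_exists [a /fin_all_exists [a' aE]]] :=
  fin_all_exists (fun j => ev_mul (f j)).
pose P v := v = 1 \/ exists j h, v = translate h (f j).
pose w (u : option {j : 'I_n & 'I_(N j)}) : coord G :=
  if u is Some t then a (tag t) (tagged t) else 1.
have Pw v : P v -> in_span w v.
  move=> [->|[j [h ->]]]; first exact: (in_span_mem w None).
  have -> : translate h (f j) = \sum_l ev h (a' j l) *: a j l.
    apply: ev_ext => g; rewrite ev_translate aE ev_comb.
    by apply: eq_bigr => l _; rewrite mulrC.
  apply: in_span_sum => l.
  exact: (in_span_mem w (Some (Tagged (fun j => 'I_(N j)) l))).
have P1 : P 1 by left.
have [m [b [b1 Pb bi bP]]] := max_independent Pw P1 (oner_neq0 _).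
have Pt h i : P (translate h (b i)).
  case: (Pb i) => [->|[j [h' ->]]]; first by left; rewrite translate1.
  right; exists j, (h * h')%g; apply: ev_ext => g.
  by rewrite !ev_translate mulgA.
have [c cE] := choice (fun u : G * 'I_m.+1 => bP _ (Pt u.1 u.2)).
pose A h : 'M[k]_m.+1 := \matrix_(l, i) c (h, i) l.
have bA g h i : ev (g * h)%g (b i) = \sum_l ev g (b l) * A h l i.
  rewrite -ev_translate (cE (h, i)) ev_comb.
  by apply: eq_bigr => l _; rewrite mxE mulrC.
have Ainj (B C : 'M[k]_m.+1) : (forall g i,
    \sum_l ev g (b l) * B l i = \sum_l ev g (b l) * C l i) -> B = C.
  move=> BC; apply/matrixP => l i.
  apply: (ev_independent_coeffs (V := k^o) (u := fun l => B l i)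
    (v := fun l => C l i) bi _ l) => g.
  exact: BC.
exists m, b, A; split=> //.
  move=> j; apply: bP; right; exists j, 1%g.
  by apply: ev_ext => g; rewrite ev_translate mulg1.
split; last first.
  move=> h; suff A0 l : A h l ord0 = (l == ord0)%:R.
    by apply/colP => l; rewrite [LHS]mxE A0 [RHS]mxE eqxx andbT.
  apply: (ev_independent_coeffs (V := k^o) (u := fun l => A h l ord0)
    (v := fun l => (l == ord0)%:R) bi _ l) => g.
  have -> : \sum_j ev g (b j) *: (A h j ord0 : k^o) = 1.
    by have := bA g h ord0; rewrite b1 rmorph1 => ->.
  rewrite (bigD1 ord0) //= big1 => [|j /negPf ->]; last exact: mulr0.
  by rewrite b1 rmorph1 addr0; apply/esym/mulr1.
split.
- apply: Ainj => g i; rewrite -bA mulg1 (bigD1 i) //= mxE eqxx mulr1.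
  by rewrite big1 ?addr0 // => l /negPf li; rewrite mxE li mulr0.
- move=> h h'; apply: Ainj => g i; rewrite -bA mulgA bA.
  under eq_bigr => l _ do rewrite bA mulr_suml.
  rewrite exchange_big; apply: eq_bigr => l _ /=.
  by rewrite mxE mulr_sumr; apply: eq_bigr => l' _; rewrite mulrA.
(* Read off at the points [x t], the [l]-th coordinate of the translate of [b i] by [h] is, as a
   function of [h], a combination of left translates of [b i]. *)
- have [x [C xC]] := dual_points bi.
  move=> l i; exists (\sum_t C l t *: ltranslate (x t) (b i)) => h.
  rewrite ev_comb; under eq_bigr => t _ do rewrite ev_ltranslate bA mulr_sumr.
  rewrite exchange_big (bigD1 l) //= [X in _ + X]big1 => [|j /negPf jl].
    under eq_bigr => t _ do rewrite mulrA.
    by rewrite addr0 -mulr_suml xC eqxx mul1r.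
  under eq_bigr => t _ do rewrite mulrA.
  by rewrite -mulr_suml xC eq_sym jl mul0r.
Qed.

End Regular.

(** * Integrals, and their existence under linear reductivity *)

HB.instance Definition _ (k : closedFieldType) (G : affine_group k)
    (R : module_algebra G) g :=
  GRing.isZmodMorphism.Build R R (alg_act g) (@alg_actB k G R g).
HB.instance Definition _ (k : closedFieldType) (G : affine_group k)
    (R : module_algebra G) g :=
  GRing.isMonoidMorphism.Build R R (alg_act g) (alg_act1 R g, alg_actM g).

Section Integrals.
Variables (k : closedFieldType) (G : affine_group k) (R : module_algebra G).

Local Notation "A ^R" := (map_mx (alg_scalar R) A) (at level 2, format "A ^R").

(** The row [v] is the linear map sending the [j]-th basis vector to [v 0 j]; equivariance becomes
    [g . v = v A(g)]. *)
Definition has_integrals : Prop :=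
  forall n (A : G -> 'M[k]_n) (c : 'cV[k]_n),
    matrix_rep A -> (forall g, A g *m c = c) -> c != 0 ->
  exists v : 'rV[R]_n, (forall g, map_mx (alg_act g) v = v *m (A g)^R) /\
    v *m c^R = 1%:M.

Lemma map_mx_act_scalar g m n (A : 'M[k]_(m, n)) : map_mx (alg_act g) A^R = A^R.
Proof. by apply/matrixP => i j; rewrite !mxE alg_act_scalar. Qed.

Section Twist.
Variables (n : nat) (A : G -> 'M[k]_n).

Definition twist_act g (v : 'rV[R]_n) : 'rV[R]_n :=
  map_mx (alg_act g) v *m (A g^-1%g)^R.

Lemma twist_actD g : {morph twist_act g : u v / u + v}.
Proof. by move=> u v; rewrite /twist_act map_mxD mulmxDl. Qed.

Lemma twist_actZ g r v : twist_act g (r *: v) = alg_act g r *: twist_act g v.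
Proof. by rewrite /twist_act map_mxZ scalemxAl. Qed.

Hypothesis repA : matrix_rep A.

Lemma twist_act1 v : twist_act 1%g v = v.
Proof.
case: repA => A1 _ _; rewrite /twist_act invg1 A1 map_mx1 mulmx1.
by apply/matrixP => i j; rewrite mxE alg_act_id.
Qed.

Lemma twist_actM g h v : twist_act (g * h)%g v = twist_act g (twist_act h v).
Proof.
case: repA => _ AM _; rewrite /twist_act invgM AM !map_mxM map_mx_act_scalar.
rewrite mulmxA; congr (_ *m _ *m _).
by apply/matrixP => i j; rewrite !mxE alg_actMg.
Qed.

Lemma twist_act_regular v :
  regular_map (V := restrict_scalars (alg_scalar R) 'rV[R]_n)
    (fun g => twist_act g v).
Proof.
case: repA => _ _ Areg.
pose V := restrict_scalars (alg_scalar R) 'rV[R]_n.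
have [a aE] : exists a : 'I_n * 'I_n -> coord G,
    forall u g, ev g (a u) = A g u.1 u.2.
  by have [a aE] := choice (fun u : 'I_n * 'I_n => Areg u.1 u.2); exists a.
pose F (u : 'I_n * 'I_n) g : V :=
  ev g (coinverse (a u)) *: (alg_act g (v 0 u.1) *: delta_mx 0 u.2 : V).
have FE g : twist_act g v = \sum_u F u g.
  apply/rowP => j; rewrite /twist_act mxE summxE.
  have -> : \sum_u F u g 0 j = \sum_i \sum_l F (i, l) g 0 j.
    by rewrite pair_bigA; apply: eq_bigr => -[].
  apply: eq_bigr => i _.
  rewrite (bigD1 j) //= big1 ?addr0 => [|l /negPf lj].
    by rewrite /F restrict_scaleE !mxE !eqxx mulr1 ev_coinverse aE mulrC.
  by rewrite /F restrict_scaleE !mxE eq_sym lj andbF !mulr0.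
have [m [f [w fw]]] : regular_map (fun g => \sum_u F u g).
  apply: regular_map_sum => u; apply: regular_map_scale.
  have [m [f [w fw]]] := alg_rat (v 0 u.1).
  exists m, f, (fun j => w j *: delta_mx 0 u.2) => g.
  rewrite fw scaler_suml; apply: eq_bigr => j _.
  by rewrite restrict_scaleE scalerA.
by exists m, f, w => g; rewrite FE.
Qed.

Lemma twist_rational :
  @rational_action k G (restrict_scalars (alg_scalar R) 'rV[R]_n) twist_act.
Proof.
split=> [v|g h v|g a u v|v]; [exact: twist_act1|exact: twist_actM| |].
  by rewrite !restrict_scaleE twist_actD twist_actZ alg_act_scalar.
exact: twist_act_regular.
Qed.

(* [(g . phi)(e) = g . phi(g^-1 . e)] on the space of linear maps from the
   representation [A] to [R]. *)
Definition twist_module : gr_module R := GRModule twist_rational twist_actZ.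

End Twist.

Fact zero_idealB : {in pred1 (0 : R) &, forall u v, u - v \in pred1 0}.
Proof. by move=> u v /eqP -> /eqP ->; rewrite subr0 inE. Qed.
Fact zero_idealM r : {in pred1 (0 : R), forall u, r * u \in pred1 0}.
Proof. by move=> u /eqP ->; rewrite mulr0 inE. Qed.
Fact zero_ideal_stable g : {in pred1 (0 : R), forall u, alg_act g u \in pred1 0}.
Proof. by move=> u /eqP ->; rewrite alg_act0 inE. Qed.

Definition zero_ideal : stable_ideal R :=
  @StableIdeal k G R (pred1 0) (eqxx 0) zero_idealB zero_idealM zero_ideal_stable.

Lemma linearly_reductive_has_integrals : linearly_reductive R -> has_integrals.
Proof.
move=> lrR n A c repA Ac c0.
pose lam (v : twist_module repA) : quotient_module zero_ideal :=
  ideal_class zero_ideal ((v *m c^R) 0 0).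
have lam_lin : linear lam.
  move=> a u v; rewrite /lam mulmxDl -scalemxAl mxE mxE ideal_classD.
  by rewrite ideal_quot_scaleE.
pose lamL : {linear twist_module repA -> quotient_module zero_ideal} :=
  HB.pack lam (GRing.isLinear.Build _ _ _ _ lam lam_lin).
(* With the ideal 0, a fixed preimage of the class of 1 takes the value 1 itself at [c]. *)
have [] := lrR _ _ lamL.
- move=> g v; rewrite /= /lam ideal_quot_actE /= /twist_act -mulmxA.
  rewrite -map_mxM Ac -[in LHS](map_mx_act_scalar g) -map_mxM mxE.
  by [].
- move=> y; have [r ->] := ideal_class_ex y.
  have [j cj] : exists j, c j 0 != 0.
    apply/existsP; apply: contraNT c0 => /existsPn c0.
    by apply/eqP/colP => j; rewrite mxE; apply/eqP/negPn/c0.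
  (* The [j]-th coordinate form, scaled to take the value [r] at [c]. *)
  exists (r *: ((c j 0)^-1%:M *m delta_mx 0 j : 'rV[k]_n)^R).
  rewrite /= /lam -scalemxAl -map_mxM -mulmxA mxE mxE mul_scalar_mx -rowE !mxE.
  by rewrite mulVf // rmorph1 mulr1.
- move=> v [vfix /ideal_classP]; rewrite inE subr_eq0 => /eqP vc.
  exists v; split=> [g|]; last by rewrite [LHS]mx11_scalar vc.
  rewrite -[in RHS](vfix g) /= /twist_act -mulmxA -map_mxM.
  by rewrite matrix_repVK // map_mx1 mulmx1.
Qed.

End Integrals.

(** * Averaging, and linear reductivity from integrals *)

Section Averaging.
Variables (k : closedFieldType) (G : affine_group k) (R : module_algebra G).

(* If [phi : k[G] -> R] is equivariant, linear and unital on the stable span of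
   the [f_j], then [s_j = phi(f_j)]: the element [\sum_j s_j *: w_j] is the
   integral of [F] against [phi]. *)
Lemma average (X : lmodType R) (act : G -> X -> X) n (f : 'I_n -> coord G)
    (w : 'I_n -> X) (F : G -> X) :
    has_integrals R ->
    (forall g, {morph act g : x y / x + y}) ->
    (forall g r x, act g (r *: x) = alg_act g r *: act g x) ->
    (forall g, F g = \sum_j alg_scalar R (ev g (f j)) *: w j) ->
    (forall g h, act h (F (g * h)%g) = F g) ->
  exists s : 'I_n -> R, (forall h, act h (\sum_j s j *: w j) = \sum_j s j *: w j) /\
    forall (Y : lmodType R) (lam : {linear X -> Y}) y,
      (forall g, lam (F g) = y) -> lam (\sum_j s j *: w j) = y.
Proof.
move=> intR actD actZ FE Finv.
have act0 h : act h 0 = 0.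
  by apply: (@addrI _ (act h 0)); rewrite -actD !addr0.
have act_sum h m (u : 'I_m -> X) : act h (\sum_j u j) = \sum_j act h (u j).
  by apply: (big_morph (act h)); [exact: actD | exact: act0].
have [m [b [A [b1 bi /choice [C fE] bA [repA A0]]]]] := stable_span f.
(* The fixed vector is the constant function 1 in the basis [b], so the integral is unital. *)
have [] := intR _ A (delta_mx ord0 0) repA.
- by move=> g; rewrite -colE.
- apply/eqP => /colP /(_ ord0); rewrite !mxE !eqxx /= => /eqP.
  by rewrite oner_eq0.
move=> v [vA v1].
have v0 : v 0 ord0 = 1.
  by move/matrixP/(_ 0 0): v1; rewrite map_delta_mx -colE !mxE eqxx mulr1n.
pose W i := \sum_j alg_scalar R (C j i) *: w j.
have FW g : F g = \sum_i alg_scalar R (ev g (b i)) *: W i.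
  rewrite FE; under eq_bigr => j _ do
    rewrite fE ev_comb rmorph_sum scaler_suml.
  rewrite exchange_big; apply: eq_bigr => i _; rewrite scaler_sumr.
  by apply: eq_bigr => j _; rewrite scalerA rmorphM mulrC.
pose s j := \sum_i alg_scalar R (C j i) * v 0 i.
have sW : \sum_j s j *: w j = \sum_i v 0 i *: W i.
  under eq_bigr do rewrite scaler_suml.
  rewrite exchange_big; apply: eq_bigr => i _; rewrite scaler_sumr.
  by apply: eq_bigr => j _; rewrite scalerA mulrC.
exists s; rewrite sW; split.
  move=> h; rewrite act_sum; under eq_bigr => i _ do rewrite actZ.
  have vAi i : alg_act h (v 0 i) = \sum_l v 0 l * alg_scalar R (A h l i).
    move/matrixP/(_ 0 i): (vA h); rewrite !mxE => ->.
    by apply: eq_bigr => l _; rewrite mxE.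
  under eq_bigr => i _ do rewrite vAi scaler_suml.
  rewrite exchange_big; apply: eq_bigr => l _.
  under eq_bigr do rewrite -scalerA; rewrite -scaler_sumr; congr (_ *: _).
  (* What remains is the invariance of [F], compared coefficient by coefficient along [b]. *)
  move: l; apply: (ev_independent_coeffs
    (V := restrict_scalars (alg_scalar R) X) bi) => g.
  rewrite -[RHS]FW -(Finv g h) FW act_sum.
  under [RHS]eq_bigr => i _ do
    rewrite actZ alg_act_scalar bA rmorph_sum scaler_suml.
  rewrite [RHS]exchange_big; apply: eq_bigr => l _ /=.
  rewrite restrict_scaleE scaler_sumr; apply: eq_bigr => i _.
  by rewrite scalerA rmorphM.
move=> Y lam y Fy.
(* [lam] maps [F] to the constant [y], so only the coefficient of [b ord0 = 1] survives. *)
have lamW l : lam (W l) = (l == ord0)%:R *: y.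
  apply: (ev_independent_coeffs (V := restrict_scalars (alg_scalar R) Y)
    (u := fun l => lam (W l)) (v := fun l => (l == ord0)%:R *: y) bi _ l) => g.
  rewrite [RHS](bigD1 ord0) //= [X in _ + X]big1 => [|j /negPf ->]; last first.
    by rewrite restrict_scaleE scale0r scaler0.
  rewrite b1 rmorph1 addr0 !scale1r -[RHS](Fy g) FW linear_sum.
  by apply: eq_bigr => j _; rewrite linearZ.
rewrite linear_sum (bigD1 ord0) //= big1 => [|j /negPf j0]; last first.
  by rewrite linearZ /= lamW j0 scale0r scaler0.
by rewrite linearZ /= lamW eqxx v0 !scale1r addr0.
Qed.

Lemma has_integrals_linearly_reductive : has_integrals R -> linearly_reductive R.
Proof.
move=> intR M J lam lam_eq lam_surj.
have [m0 m0E] := lam_surj (ideal_class J 1).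
have [_ actM actL actR] := gr_rational M.
have [n [f [w fw]]] := regular_mapV (actR m0).
(* The inverse yields [h F(g h) = F(g)], and every [F g] is again a preimage of the class of 1,
   which is fixed. *)
have [] := average (act := @gr_act _ _ _ M) (f := f) (w := w)
  (F := fun g => gr_act g^-1%g m0) intR.
- by move=> g u v; have := actL g 1 u v; rewrite !scale1r.
- exact: gr_actZ.
- exact: fw.
- by move=> g h; rewrite -actM invgM mulgA mulgV mul1g.
move=> s [sfix slam]; exists (\sum_j s j *: w j); split=> //.
by apply: slam => g; rewrite lam_eq m0E /= ideal_quot_actE alg_act1.
Qed.

End Averaging.

(** * Restriction to a subgroup *)

Section Transfer.
Variables (k : closedFieldType) (K G : affine_group k) (i : group_morphism K G).

Lemma matrix_rep_restrict n (A : G -> 'M[k]_n) :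
  matrix_rep A -> matrix_rep (fun x => A (i x)).
Proof.
move=> [A1 AM Areg]; split; first by rewrite gmor1.
  by move=> x y; rewrite gmorM AM.
move=> j l; have [f fE] := Areg j l; have [f' f'E] := gmor_regular i f.
by exists f' => x; rewrite -fE; exact: f'E.
Qed.

Lemma has_integrals_translationP :
  has_integrals (restrict_algebra i (translation_algebra G)) <->
  forall n (A : K -> 'M[k]_n) (c : 'cV[k]_n),
    matrix_rep A -> (forall x, A x *m c = c) -> c != 0 ->
  exists r : 'rV[coord G]_n,
    (forall g x, map_mx (ev (g * i x)%g) r = map_mx (ev g) r *m A x) /\
    (forall g, map_mx (ev g) r *m c = 1%:M).
Proof.
have ev_mx g m n p (r : 'M[coord G]_(m, n)) (B : 'M[k]_(n, p)) :
    map_mx (ev g) (r *m map_mx (GRing.in_alg (coord G)) B) = map_mx (ev g) r *m B.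
  rewrite map_mxM; congr (_ *m _); apply/matrixP => a b; rewrite !mxE.
  by rewrite /= evZ rmorph1 mulr1.
have ev_mx_ext m n (r s : 'M[coord G]_(m, n)) :
    (forall g, map_mx (ev g) r = map_mx (ev g) s) -> r = s.
  move=> rs; apply/matrixP => a b; apply: ev_ext => g.
  by have /matrixP/(_ a b) := rs g; rewrite !mxE.
split=> intK n A c repA Ac c0; have [r [rA rc]] := intK n A c repA Ac c0.
  exists r; split=> [g x|g]; last by rewrite -ev_mx [X in map_mx _ X]rc map_mx1.
  rewrite -ev_mx -[X in _ = map_mx _ X]rA.
  by apply/matrixP => a b; rewrite !mxE -ev_translate.
exists r; split=> [x|]; apply: ev_mx_ext => g.
  rewrite [RHS]ev_mx -rA.
  by apply/matrixP => a b; rewrite !mxE -ev_translate.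
by rewrite [LHS]ev_mx rc map_mx1.
Qed.

(** The map [r] to [k[G]] lands in the span of [b], with matrix [D]. As [b] is independent, [D] is
    [K]-equivariant and sends [c] to the coordinates of 1; [v D] is its composite with the [G]-map
    [v] from that span to [R]. *)
Lemma has_integrals_restrict (R : module_algebra G) :
  has_integrals (restrict_algebra i (translation_algebra G)) ->
  has_integrals R -> has_integrals (restrict_algebra i R).
Proof.
move=> /has_integrals_translationP intK intR n A c repA Ac c0.
have [r [rA rc]] := intK n A c repA Ac c0.
have [m [b [B [b1 bi /choice [C rC] bB [repB B0]]]]] :=
  stable_span (fun j => r 0 j).
have [] := intR _ B (delta_mx ord0 0) repB.
- by move=> g; rewrite -colE.
- apply/eqP => /colP /(_ ord0); rewrite !mxE !eqxx /= => /eqP.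
  by rewrite oner_eq0.
move=> v [vB v1].
pose D : 'M[k]_(_, n) := \matrix_(l, j) C j l.
pose brow g : 'rV[k]_m.+1 := \row_l ev g (b l).
have rD g : map_mx (ev g) r = brow g *m D.
  apply/rowP => j; rewrite !mxE rC ev_comb; apply: eq_bigr => l _.
  by rewrite !mxE mulrC.
have browM g h : brow (g * h)%g = brow g *m B h.
  by apply/rowP => j; rewrite !mxE bB; apply: eq_bigr => l _; rewrite !mxE.
have brow_inj p (S T : 'M[k]_(m.+1, p)) :
    (forall g, brow g *m S = brow g *m T) -> S = T.
  move=> ST; apply/matrixP => l j.
  apply: (ev_independent_coeffs (V := k^o) (u := fun l => S l j)
    (v := fun l => T l j) bi _ l) => g.
  have /rowP/(_ j) := ST g; rewrite !mxE.
  by under eq_bigr do rewrite mxE; under [in RHS]eq_bigr do rewrite mxE.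
have BD x : B (i x) *m D = D *m A x.
  by apply: brow_inj => g; rewrite !mulmxA -browM -!rD rA.
have Dc : D *m c = delta_mx ord0 0.
  apply: brow_inj => g; rewrite mulmxA -rD rc -colE.
  by apply/matrixP => a d; rewrite !ord1 !mxE b1 eqxx [RHS]rmorph1.
exists (v *m map_mx (alg_scalar R) D); split=> [x|]; last first.
  by rewrite /= -mulmxA -map_mxM Dc.
rewrite map_mxM /= [X in _ *m X]map_mx_act_scalar vB -!mulmxA.
by rewrite -!map_mxM BD.
Qed.

End Transfer.

(** * Descent to the quotient group, and extensions *)

Section Quotient.
Variables (k : closedFieldType) (K G : affine_group k) (i : group_morphism K G).
Variables (Q : quotient_group i) (R : module_algebra G).

Local Notation RK := (fixed_ring (restrict_algebra i R)).

Definition fixed_val : {rmorphism RK -> R} := (val : RK -> R).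

Lemma quo_proj_restrict x : quo_proj Q (i x) = 1%g.
Proof. by apply/quo_ker; exists x. Qed.

(** A representation of [Q] pulled back to [G] is trivial on [K], so an equivariant map from it to
    [R] has [K]-fixed entries. *)
Lemma has_integrals_fixed : has_integrals R -> has_integrals (fixed_algebra Q R).
Proof.
move=> intR n A c repA Ac c0.
have repB := matrix_rep_restrict (quo_proj Q) repA.
have [//|v [vB vc]] := intR _ _ c repB _ c0.
have [A1 _ _] := repA.
have vK j : v 0 j \in fixed_pred (restrict_algebra i R).
  apply/fixedP => x; have /rowP/(_ j) := vB (i x).
  by rewrite quo_proj_restrict A1 map_mx1 mulmx1 mxE.
pose u : 'rV[RK]_n := \row_j exist _ (v 0 j) (vK j).
have uE : map_mx fixed_val u = v by apply/rowP => j; rewrite !mxE.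
have valI m p (M N : 'M[RK]_(m, p)) :
    map_mx fixed_val M = map_mx fixed_val N -> M = N.
  move=> /matrixP MN; apply/matrixP => a b; apply: val_inj.
  by have := MN a b; rewrite !mxE.
have scE m p (M : 'M[k]_(m, p)) :
    map_mx fixed_val (map_mx (alg_scalar (fixed_algebra Q R)) M) =
    map_mx (alg_scalar R) M by apply/matrixP => a b; rewrite !mxE.
exists u; split=> [q|]; apply: valI; rewrite [RHS](map_mxM fixed_val, map_mx1).
  have [g <-] := quo_surj q; rewrite uE scE -vB.
  by apply/rowP => j; rewrite !mxE [LHS]fixed_act_proj.
by rewrite [LHS](map_mxM fixed_val) uE scE vc.
Qed.

(** A [K]-map [r : V -> R] is a [K]-fixed vector of [Hom(V, R)]. The map [g |-> g^-1 r] depends only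
    on the coset of [g] and is averaged over [Q]; all its values send [c] to 1, hence so does the
    average. *)
Lemma has_integrals_extension :
  has_integrals (restrict_algebra i R) -> has_integrals (fixed_algebra Q R) ->
  has_integrals R.
Proof.
move=> intK intQ n A c repA Ac c0.
have [//|r [rA rc]] := intK _ _ c (matrix_rep_restrict i repA) _ c0.
pose star := twist_act (R := R) A.
have starM g h u : star (g * h)%g u = star g (star h u) by exact: twist_actM.
have starZ g a u : star g (a *: u) = alg_act g a *: star g u by exact: twist_actZ.
have rfix x : star (i x) r = r.
  rewrite /star /twist_act [map_mx _ r]rA -mulmxA -map_mxM.
  by rewrite matrix_repK // map_mx1 mulmx1.
have [n' [f0 [w0 Fw0]]] := regular_mapV (twist_act_regular repA r).
have [m [f [w [Fw fi wi]]]] := @independent_expansion _ _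
  (restrict_scalars (alg_scalar R) 'rV[R]_n) (fun g => star g^-1%g r) _ f0 w0 Fw0.
have star_sum h p (u : 'I_p -> 'rV[R]_n) :
    star h (\sum_j u j) = \sum_j star h (u j).
  apply: (big_morph (star h)); first exact: twist_actD.
  by rewrite /star /twist_act map_mx0 mul0mx.
have rG x g : star (i x) (star g r) = star g r.
  by have [y yE] := quo_conj Q g x; rewrite -starM yE starM rfix.
(* [K] fixes all translates of [r]; by independence of both families, the [w j] are [K]-fixed and
   the [f j] descend to [Q]. *)
have wK x j : star (i x) (w j) = w j.
  move: j; apply: (ev_independent_coeffs
    (V := restrict_scalars (alg_scalar R) 'rV[R]_n)
    (u := fun j => star (i x) (w j)) (v := w) fi) => g.
  rewrite -[RHS]Fw -[RHS](rG x).
  rewrite Fw star_sum; apply: eq_bigr => j _.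
  by rewrite !restrict_scaleE [RHS]starZ alg_act_scalar.
have fK j g x : ev (g * i x)%g (f j) = ev g (f j).
  move: j; apply: (independent_inj wi); rewrite -!Fw invgM starM.
  by rewrite -gmorV rG.
have [f' f'E] := choice (fun j => quo_coord Q (fK j)).
(* A set-theoretic section, multiplicative only up to [K]; by normality the errors can be moved to
   the right, where they fix [r]. *)
pose l : Q -> G := @quo_lift _ _ _ _ Q.
have lM p q : exists x, (l p * l q)%g = (l (p * q)%g * i x)%g.
  by apply: (@quo_fiber _ _ _ _ Q); rewrite gmorM !quo_liftK.
have [] := @average _ Q (fixed_algebra Q R) (restrict_scalars fixed_val 'rV[R]_n)
  (fun q => star (l q)) m f' w (fun q => star (l q)^-1%g r) intQ.
- by move=> q; exact: twist_actD.
- by move=> q a u; exact: starZ.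
- move=> q; rewrite Fw; apply: eq_bigr => j _.
  by rewrite [LHS]restrict_scaleE -f'E quo_liftK.
- move=> p q; have [x xE] := lM p q.
  have -> : (l (p * q)%g)^-1%g = (i x * (l q)^-1 * (l p)^-1)%g.
    by rewrite -mulgA -invgM xE invgM mulgA mulgV mul1g.
  have [y yE] := quo_conj Q (l q)^-1%g x.
  have [z zE] := quo_conj Q (l p)^-1%g y.
  by rewrite yE -mulgA zE -starM !mulgA mulgV mul1g starM rfix.
move=> s [sfix slam].
pose v : 'rV[R]_n := \sum_j s j *: (w j : restrict_scalars fixed_val 'rV[R]_n).
have vK x : star (i x) v = v.
  rewrite /v star_sum; apply: eq_bigr => j _.
  by rewrite restrict_scaleE starZ [alg_act _ _]fixed_actE wK.
have vG g : star g v = v.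
  have [|x ->] := @quo_fiber _ _ _ _ Q g (l (quo_proj Q g)).
    by rewrite quo_liftK.
  by rewrite starM vK [LHS]sfix.
exists v; split=> [g|].
  rewrite -[in RHS](vG g) /star /twist_act -mulmxA -map_mxM.
  by rewrite matrix_repVK // map_mx1 mulmx1.
(* Evaluation at [c] is taken as a linear map over [R^K], the ring over which the average is
   formed. *)
pose X p := restrict_scalars fixed_val 'rV[R]_p.
pose lam (u : X n) : X 1 := (u : 'rV[R]_n) *m map_mx (alg_scalar R) c.
have lam_lin : linear lam.
  by move=> a u u'; rewrite /lam mulmxDl !restrict_scaleE scalemxAl.
pose lamL : {linear X n -> X 1} :=
  HB.pack lam (GRing.isLinear.Build _ _ _ _ lam lam_lin).
apply: (slam _ lamL 1%:M) => q; rewrite /= /lam /star /twist_act -mulmxA -map_mxM Ac.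
rewrite -[in LHS](map_mx_act_scalar R (l q)^-1%g) -map_mxM [X in map_mx _ X]rc.
by rewrite map_mx1.
Qed.

End Quotient.

(** * Inverse characters for a normal subgroup *)

Section NormalInclusion.
Variables (k : closedFieldType) (K G : affine_group k) (i : group_morphism K G).

Fact corestrict_ex (f : coord G) : {f' : coord K | forall x, ev x f' = ev (i x) f}.
Proof. exact/cid/(gmor_regular i f). Qed.

Definition corestrict (f : coord G) : coord K := sval (corestrict_ex f).

Lemma ev_corestrict f x : ev x (corestrict f) = ev (i x) f.
Proof. exact: (svalP (corestrict_ex f)). Qed.

Lemma normal_conj (g : G) (x : K) : normal_inclusion i ->
  exists y : K, (i x * g)%g = (g * i y)%g.
Proof.
move=> norm; have [y yE] := norm g^-1%g x; exists y.
by rewrite yE invgK !mulgA mulgV mul1g.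
Qed.

(* The characters [x |-> f(g x^-1 g^-1)] of [K] span a finite-dimensional space
   and distinct characters are independent, so the [g] for which it equals
   [f(x^-1)] are cut out by evaluations on finitely many [x]; [f''] is
   [f(g^-1)] restricted to this set. *)
Lemma inverse_weight (f : coord G) : normal_inclusion i -> ev 1%g f = 1 ->
    (forall g x, ev (g * i x)%g f = ev g f * ev (i x) f) ->
  exists f'' : coord G, ev 1%g f'' = 1 /\
    forall g x, ev (g * i x)%g f'' = ev g f'' * ev (i x^-1%g) f.
Proof.
move=> norm f1 fM.
pose H g := coinverse (corestrict (ltranslate g (translate g^-1%g f))).
have HE g x : ev x (H g) = ev (g * i x^-1%g * g^-1)%g f.
  by rewrite ev_coinverse ev_corestrict ev_ltranslate ev_translate.
(* Two uses of [ev_mul] separate [g] from [x], so all [H g] lie in one finite-dimensional space. *)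
have [n [a [b ab]]] := ev_mul f.
have [N /fin_all_exists [a' /fin_all_exists [b' ab']]] :=
  fin_all_exists (fun j => ev_mul (b j)).
pose w (u : {j : 'I_n & 'I_(N j)}) := coinverse (corestrict (a' (tag u) (tagged u))).
have Hw v : (exists g, v = H g) -> in_span w v.
  move=> [g ->].
  have -> : H g = \sum_j ev g (a j) *: \sum_l ev g^-1%g (b' j l) *:
      w (Tagged (fun j => 'I_(N j)) l).
    apply: ev_ext => x; rewrite HE -mulgA ab ev_comb; apply: eq_bigr => j _.
    rewrite ab' ev_comb; congr (_ * _); apply: eq_bigr => l _.
    by rewrite ev_coinverse ev_corestrict mulrC.
  by apply: in_span_sum => j; apply: in_span_sum => l; exact: in_span_mem.
have H1 : ev 1%g (H 1%g) = 1 by rewrite HE !invg1 gmor1 !mulg1 f1.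
have H1n0 : H 1%g != 0.
  by apply/eqP => H0; move/eqP: H1; rewrite H0 rmorph0 eq_sym oner_eq0.
have [m [v [v0 Pv vi Pspan]]] := max_independent Hw (ex_intro _ 1%g erefl) H1n0.
have [c cE] := choice (fun g => Pspan _ (ex_intro _ g erefl)).
have fK x y : ev (i (x * y)%g) f = ev (i x) f * ev (i y) f by rewrite gmorM fM.
have HM g x y : ev (x * y)%g (H g) = ev x (H g) * ev y (H g).
  have [x' x'E] := norm g x^-1%g; have [y' y'E] := norm g y^-1%g.
  rewrite !HE -x'E -y'E mulrC -fK gmorM x'E y'E !mulgA -(mulgA _ g^-1%g) mulVg.
  by rewrite mulg1 invgM gmorM !mulgA.
pose f' := coinverse f.
have f'M g x : ev (g * i x)%g f' = ev x (H g) * ev g f'.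
  rewrite HE !ev_coinverse mulrC; have [y yE] := norm g x^-1%g.
  by rewrite -yE -fM yE invgM gmorV !mulgA mulVg mul1g.
(* Each [v j] is a character, so comparing [(H g)(x y)] with [(H g)(x) (H g)(y)] along [v] shows
   that [c g ord0] vanishes unless [H g = H 1]. *)
have cH g x : c g ord0 * ev x (H 1%g) = ev x (H g) * c g ord0.
  rewrite -v0.
  apply: (independent_inj (c := fun j => c g j * ev x (v j))
    (d := fun j => ev x (H g) * c g j) vi).
  apply: ev_ext => y; rewrite !ev_comb.
  transitivity (ev (x * y)%g (H g)).
    rewrite cE ev_comb; apply: eq_bigr => j _; rewrite -mulrA; congr (_ * _).
    by have [h ->] := Pv j; rewrite HM.
  rewrite HM [in ev y _]cE ev_comb mulr_sumr; apply: eq_bigr => j _.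
  by rewrite mulrA.
have [z [C zC]] := dual_points vi.
(* [c g ord0] is the indicator of [H g = H 1]. By [f'M] and the dual points, its product with
   [f(g^-1)] is a combination of translates of [f'], hence regular. *)
have f''E g : ev g (\sum_l C ord0 l *: translate (i (z l)) f') = c g ord0 * ev g f'.
  rewrite ev_comb; under eq_bigr => l _ do rewrite ev_translate f'M mulrA.
  rewrite -mulr_suml; congr (_ * _); rewrite cE.
  under eq_bigr => l _ do rewrite ev_comb mulr_sumr.
  rewrite exchange_big (bigD1 ord0) //= [X in _ + X]big1 => [|j /negPf j0].
    under eq_bigr => l _ do rewrite mulrCA.
    by rewrite -mulr_sumr zC eqxx mulr1 addr0.
  under eq_bigr => l _ do rewrite mulrCA.
  by rewrite -mulr_sumr zC eq_sym j0 mulr0.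
exists (\sum_l C ord0 l *: translate (i (z l)) f'); split.
  rewrite f''E ev_coinverse invg1 f1 mulr1.
  suff /(_ ord0) : c 1%g =1 (fun j => (j == ord0)%:R) by rewrite eqxx.
  apply: (independent_inj vi); rewrite -cE (bigD1 ord0) //= scale1r v0.
  by rewrite big1 ?addr0 // => j /negPf ->; rewrite scale0r.
move=> g x; rewrite !f''E f'M.
(* Replacing [g] by [g * i x] conjugates inside [K], where [f] is multiplicative; [H] and its
   coordinates do not change. *)
have -> : c (g * i x)%g = c g.
  apply/funext; apply: (independent_inj vi); rewrite -!cE; apply: ev_ext => y.
  rewrite !HE; have [y' y'E] := norm g y^-1%g; have [x' x'E] := norm g x.
  have -> : (g * i x * i y^-1 * (g * i x)^-1 = i (x' * y' * x'^-1))%g.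
    by rewrite !gmorM (gmorV i x') x'E y'E !invgM invgK !mulgA !mulgVK.
  by rewrite !fK mulrAC -fK mulgV gmor1 f1 mul1r y'E.
have -> : ev (i x^-1%g) f = ev x (H 1%g) by rewrite HE invg1 mul1g mulg1.
by rewrite mulrA [_ * ev x (H g)]mulrC -cH mulrAC.
Qed.

End NormalInclusion.

(** * Integrals on [k[G]] for a normal subgroup *)

Section NormalTranslation.
Variables (k : closedFieldType) (K G : affine_group k) (i : group_morphism K G).

(* With [1, v_1, ..., v_p] a basis of [k + N], [N] the space of the functions
   in the span that vanish on [K], the map is
   [u |-> det (u(g_l g) | v_1(g_l g) | ... | v_p(g_l g))] up to a scalar, and
   the [q_l] are its cofactors along the first column. *)
Lemma semiequivariant_map n (b : 'I_n -> coord G) :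
    in_span b 1 -> (forall h j, in_span b (translate h (b j))) ->
  exists p (g : 'I_p -> G) (q : 'I_p -> coord G) (chi : K -> k),
    [/\ \sum_l ev 1%g (q l) = 1,
        forall l h x, ev (h * i x)%g (q l) = ev h (q l) * chi x &
        forall u, in_span b u -> (forall x, ev (i x) u = 0) ->
          forall h, \sum_l ev (g l * h)%g u * ev h (q l) = 0].
Proof.
move=> b1 bstable.
pose P (u : coord G) := u = 1 \/ in_span b u /\ forall x, ev (i x) u = 0.
have Pb u : P u -> in_span b u by case=> [->|[]].
have P1 : P 1 by left.
have [p [v [v0 Pv vi Pspan]]] := max_independent Pb P1 (oner_neq0 _).
have vn0 j : j != ord0 -> in_span b (v j) /\ forall x, ev (i x) (v j) = 0.
  move=> j0; case: (Pv j) => // vj.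
  have comb1 l : \sum_l' (l' == l)%:R *: v l' = v l.
    rewrite (bigD1 l) //= eqxx scale1r big1 ?addr0 // => l' /negPf ->.
    by rewrite scale0r.
  have /(_ j) : (fun l => (l == j)%:R : k) =1 (fun l => (l == ord0)%:R).
    by apply: (independent_inj vi); rewrite !comb1 vj v0.
  by rewrite eqxx (negPf j0) => /eqP; rewrite oner_eq0.
have v1 j : ev 1%g (v j) = (j == ord0)%:R.
  case: eqVneq => [->|/vn0 [_]]; first by rewrite v0 rmorph1.
  by move/(_ 1%g); rewrite gmor1.
have coef0 (c : 'I_p.+1 -> k) u : (forall x, ev (i x) u = 0) ->
    u = \sum_j c j *: v j -> c ord0 = 0.
  move=> /(_ 1%g); rewrite gmor1 => u0 uE; move: u0; rewrite uE ev_comb.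
  rewrite (bigD1 ord0) //= v1 mulr1 big1 ?addr0 // => j /negPf j0.
  by rewrite v1 j0 mulr0.
have [g gu] := independent_points vi.
pose M h : 'M[k]_p.+1 := \matrix_(l, j) ev (g l * h)%g (v j).
have M1 : \det (M 1%g) != 0.
  rewrite -unitfE -unitmxE; have -> : M 1%g = \matrix_(l, j) ev (g l) (v j).
    by apply/matrixP => l j; rewrite !mxE mulg1.
  exact: gu.
(* With a unit vector as first column, the determinant is the cofactor that multiplies
   [u(g_l h)]. *)
pose N0 l0 h : 'M[k]_p.+1 := \matrix_(l, j)
  if j == ord0 then (l == l0)%:R else ev (g l * h)%g (v j).
pose N l0 : 'M[coord G]_p.+1 := \matrix_(l, j)
  if j == ord0 then (l == l0)%:R else ltranslate (g l) (v j).
have NE l h : ev h (\det (N l)) = \det (N0 l h).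
  rewrite -det_map_mx; congr (\det _); apply/matrixP => l' j; rewrite !mxE.
  by case: ifP => _; [exact: rmorph_nat | exact: ev_ltranslate].
have cofE l h : \det (N0 l h) = cofactor (M h) l ord0.
  rewrite (expand_det_col _ ord0) (bigD1 l) //= [X in _ + X]big1 => [|l' /negPf ll'].
    rewrite mxE /= eqxx mul1r addr0 /cofactor; congr (_ * \det _).
    by apply/matrixP => l' j; rewrite !mxE.
  by rewrite mxE /= ll' mul0r.
have sum_cof j h : \sum_l ev (g l * h)%g (v j) * \det (N0 l h) =
    (ord0 == j)%:R * \det (M h).
  have /matrixP/(_ ord0 j) := mul_adj_mx (M h).
  rewrite mulr_natl !mxE => <-; apply: eq_bigr => l _.
  by rewrite cofE [RHS]mulrC !mxE.
have Pt x j : P (translate (i x) (v j)).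
  case: (eqVneq j ord0) => [->|/vn0 [bj vj]]; first by left; rewrite v0 translate1.
  right; split=> [|y]; last by rewrite ev_translate -gmorM vj.
  exact: in_span_translate.
have [d dE] := choice (fun u : K * 'I_p.+1 => Pspan _ (Pt u.1 u.2)).
have d0 x j : j != ord0 -> d (x, j) ord0 = 0.
  move=> /vn0 [_ vj]; apply: (coef0 _ _ _ (dE (x, j))) => y /=.
  by rewrite ev_translate -gmorM vj.
(* Block-diagonal by [d0]: 1 on the constants, and right translation by [x] on the functions
   vanishing on [K]; its determinant is the character [chi]. *)
pose D x : 'M[k]_p.+1 := \matrix_(l, j)
  if j == ord0 then (l == ord0)%:R else d (x, j) l.
have ND l0 h x : N0 l0 (h * i x)%g = N0 l0 h *m D x.
  apply/matrixP => l j; rewrite [LHS]mxE [RHS]mxE.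
  case: (eqVneq j ord0) => [->|j0].
    rewrite (bigD1 ord0) //= [X in _ + X]big1 => [|t /negPf t0].
      by rewrite !mxE /= mulr1 addr0.
    by rewrite !mxE /= t0 mulr0.
  rewrite mulgA -ev_translate (dE (x, j)) /= ev_comb; apply: eq_bigr => t _.
  rewrite !mxE (negPf j0); case: (eqVneq t ord0) => [->|_]; last by rewrite mulrC.
  by rewrite d0 // mulr0 mul0r.
(* As [v ord0 = 1], the first column of [M 1] consists of ones and its cofactors add up to
   [\det (M 1)], hence the scaling. *)
exists p.+1, g, (fun l => (\det (M 1%g))^-1 *: \det (N l)), (fun x => \det (D x)).
split=> [|l h x|u bu uK h].
- under eq_bigr do rewrite evZ NE; rewrite -mulr_sumr.
  have := sum_cof ord0 1%g; rewrite v0 mul1r.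
  under eq_bigr do rewrite rmorph1 mul1r.
  by move=> ->; rewrite mulVf.
- by rewrite !evZ !NE ND det_mulmx mulrA.
- have [c uE] : in_span v u by apply: Pspan; right.
  under eq_bigr => l _ do rewrite evZ NE mulrCA.
  rewrite -mulr_sumr uE.
  under eq_bigr => l _ do rewrite ev_comb mulr_suml.
  rewrite exchange_big big1 ?mulr0 // => j _.
  under eq_bigr do rewrite -mulrA; rewrite -mulr_sumr sum_cof.
  case: (eqVneq ord0 j) => [<-|_]; last by rewrite mul0r mulr0.
  by rewrite (coef0 _ _ uK uE) mul0r.
Qed.

(** Matrix coefficients give a [K]-map to [k[K]]. Its lift to [k[G]] is equivariant only modulo
    functions vanishing on [K]; [semiequivariant_map] kills these, and the factor [f''] cancels the
    character it introduces. *)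
Lemma equivariant_map n (A : K -> 'M[k]_n) (c : 'cV[k]_n) :
    closed_inclusion i -> normal_inclusion i ->
    matrix_rep A -> (forall x, A x *m c = c) -> c != 0 ->
  exists r : 'rV[coord G]_n,
    (forall g x, map_mx (ev (g * i x)%g) r = map_mx (ev g) r *m A x) /\
    map_mx (ev 1%g) r *m c = 1%:M.
Proof.
move=> iclosed norm [A1 AM Areg] Ac c0.
have [j0 cj0] : exists j, c j 0 != 0.
  apply/existsP; apply: contraNT c0 => /existsPn c0.
  by apply/eqP/colP => j; rewrite mxE; apply/eqP/negPn/c0.
(* Scaled so that [\sum_j c_j u_j] is 1 on [K], because [A x] fixes [c]. *)
have [u uE] : exists u : 'I_n -> coord G,
    forall j x, ev (i x) (u j) = (c j0 0)^-1 * A x j0 j.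
  suff /choice [u uE] : forall j, exists f : coord G,
      forall x, ev (i x) f = (c j0 0)^-1 * A x j0 j by exists u.
  move=> j; have [f fE] := Areg j0 j; have [f' f'E] := iclosed f.
  by exists ((c j0 0)^-1 *: f') => x; rewrite evZ -fE; congr (_ * _); exact: f'E.
have [m [b [B [b1 bi ub bB _]]]] := stable_span u.
have b_span1 : in_span b 1 by rewrite -b1; exact: in_span_mem.
have bstable h j : in_span b (translate h (b j)).
  exists (fun l => B h l j); apply: ev_ext => g.
  rewrite ev_translate bB ev_comb; apply: eq_bigr => l _; exact: mulrC.
have [p [g [q [chi [q1 qM phi0]]]]] := semiequivariant_map b_span1 bstable.
have fK x h : ev (h * i x)%g (\sum_l q l) = ev h (\sum_l q l) * chi x.
  by rewrite !rmorph_sum mulr_suml; apply: eq_bigr => l _; exact: qM.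
have f1 : ev 1%g (\sum_l q l) = 1 by rewrite rmorph_sum.
have fchi x : ev (i x) (\sum_l q l) = chi x by rewrite -[i x]mul1g fK f1 mul1r.
have [|f'' [f''1 f''M]] := inverse_weight norm f1.
  by move=> h x; rewrite fK fchi.
pose psi u h := ev h f'' * \sum_l ev (g l * h)%g u * ev h (q l).
have psi_sum (v : 'I_n -> coord G) (d : 'I_n -> k) h :
    psi (\sum_j d j *: v j) h = \sum_j d j * psi (v j) h.
  rewrite /psi; under eq_bigr => l _ do rewrite ev_comb mulr_suml.
  rewrite exchange_big mulr_sumr; apply: eq_bigr => j _.
  rewrite mulrCA; congr (_ * _); rewrite mulr_sumr.
  by apply: eq_bigr => l _; rewrite mulrA.
have psi_eq v w h : in_span b v -> in_span b w ->
    (forall x, ev (i x) v = ev (i x) w) -> psi v h = psi w h.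
  move=> bv bw vw; apply/eqP; rewrite -subr_eq0 -mulrBr -sumrB.
  under eq_bigr do rewrite -mulrBl -rmorphB.
  rewrite phi0 ?mulr0 //; first exact: in_spanB.
  by move=> x; rewrite rmorphB /= vw subrr.
have psiM v h x : psi v (h * i x)%g = psi (translate (i x) v) h.
  rewrite /psi f''M fchi; under eq_bigr => l _ do rewrite qM mulgA mulrA.
  rewrite -mulr_suml mulrACA.
  have -> : chi x^-1%g * chi x = 1 by rewrite -fchi -fK -gmorM mulVg gmor1 f1.
  by rewrite mulr1; under [in RHS]eq_bigr => l _ do rewrite ev_translate.
have psiE v h : psi v h = ev h (f'' * \sum_l ltranslate (g l) v * q l).
  rewrite rmorphM rmorph_sum; congr (_ * _); apply: eq_bigr => l _.
  by rewrite rmorphM /= ev_ltranslate.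
exists (\row_j (f'' * \sum_l ltranslate (g l) (u j) * q l)); split.
  move=> h x; apply/rowP => j; rewrite !mxE -psiE psiM.
  rewrite (psi_eq _ (\sum_t A x t j *: u t)).
  - by rewrite psi_sum; apply: eq_bigr => t _; rewrite !mxE -psiE mulrC.
  - exact: in_span_translate.
  - exact: in_span_sum.
  - move=> y; rewrite ev_translate -gmorM uE AM mxE ev_comb mulr_sumr.
    by apply: eq_bigr => t _; rewrite uE mulrA mulrC.
apply/matrixP => a a'; rewrite !ord1 !mxE eqxx.
transitivity (psi (\sum_t c t 0 *: u t) 1%g).
  by rewrite psi_sum; apply: eq_bigr => t _; rewrite !mxE -psiE mulrC.
rewrite (psi_eq _ 1).
- rewrite /psi f''1 mul1r -[RHS]q1; apply: eq_bigr => l _.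
  by rewrite rmorph1 mul1r.
- exact: in_span_sum.
- exact: b_span1.
- move=> x; rewrite rmorph1 ev_comb.
  have /colP/(_ j0) := Ac x; rewrite mxE => E.
  rewrite -[RHS](mulVf cj0) -[X in _ = _ * X]E mulr_sumr.
  by apply: eq_bigr => t _; rewrite uE mulrC mulrA.
Qed.

(** The image [t] of [c] under [r0] is [K]-invariant but normalised only at 1. Writing
    [t(x^-1 y) = \sum_j a_j(x) w_j(y)] with [K]-invariant [a_j] and setting [y = x] gives
    [\sum_j a_j w_j = 1]. Each [w_j] is a combination of left translates of [t]; the same
    combinations of translates of [r0], weighted by the [a_j], form the integral. *)
Lemma has_integrals_normal : closed_inclusion i -> normal_inclusion i ->
  has_integrals (restrict_algebra i (translation_algebra G)).
Proof.
move=> iclosed norm; apply/has_integrals_translationP => n A c repA Ac c0.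
have [r0 [r0M r0c]] := equivariant_map iclosed norm repA Ac c0.
pose t := \sum_j c j 0 *: r0 0 j.
have tE g : (ev g t)%:M = map_mx (ev g) r0 *m c.
  rewrite [RHS]mx11_scalar; congr _%:M; rewrite ev_comb mxE.
  by apply: eq_bigr => j _; rewrite mxE mulrC.
have tinj g h : map_mx (ev g) r0 *m c = map_mx (ev h) r0 *m c -> ev g t = ev h t.
  by rewrite -!tE => /matrixP/(_ 0 0); rewrite !mxE.
have tK g x : ev (g * i x)%g t = ev g t by apply: tinj; rewrite r0M -mulmxA Ac.
have t1 : ev 1%g t = 1.
  by have := tE 1%g; rewrite r0c => /matrixP/(_ 0 0); rewrite !mxE.
pose F x := ltranslate x^-1%g t.
have [m0 [a0 [w0 Fw0]]] := regular_mapV (regular_ltranslate t).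
have [m [a [w [Fw ai wi]]]] := independent_expansion (F := F) Fw0.
have aK x g j : ev (g * i x)%g (a j) = ev g (a j).
  move: j; apply: (independent_inj wi); rewrite -!Fw; apply: ev_ext => y.
  rewrite !ev_ltranslate invgM -gmorV -mulgA.
  by have [z ->] := normal_conj (g^-1 * y)%g x^-1%g norm; rewrite tK.
have [x [C xC]] := dual_points ai.
have wE j : w j = \sum_l C j l *: F (x l).
  under eq_bigr => l _ do rewrite Fw scaler_sumr.
  rewrite exchange_big (bigD1 j) //= [X in _ + X]big1 => [|j' /negPf jj'].
    under eq_bigr do rewrite scalerA.
    by rewrite -scaler_suml xC eqxx scale1r addr0.
  under eq_bigr do rewrite scalerA.
  by rewrite -scaler_suml xC eq_sym jj' scale0r.
pose r := \row_s \sum_j a j * \sum_l C j l *: ltranslate (x l)^-1%g (r0 0 s).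
have rE g : map_mx (ev g) r = \sum_j \sum_l
    (ev g (a j) * C j l) *: map_mx (ev ((x l)^-1 * g)%g) r0.
  apply/rowP => s; rewrite !mxE rmorph_sum summxE; apply: eq_bigr => j _.
  rewrite rmorphM /= ev_comb mulr_sumr summxE; apply: eq_bigr => l _.
  by rewrite !mxE ev_ltranslate mulrA.
exists r; split=> [g y|g].
  rewrite !rE mulmx_suml; apply: eq_bigr => j _.
  rewrite mulmx_suml; apply: eq_bigr => l _.
  by rewrite aK mulgA r0M scalemxAl.
rewrite rE mulmx_suml -[RHS](_ : (ev g (F g))%:M = _); last first.
  by rewrite ev_ltranslate mulVg t1.
rewrite Fw ev_comb raddf_sum; apply: eq_bigr => j _ /=.
rewrite wE ev_comb mulr_sumr raddf_sum mulmx_suml; apply: eq_bigr => l _ /=.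
by rewrite -scalemxAl -tE ev_ltranslate scale_scalar_mx mulrA.
Qed.

End NormalTranslation.

Theorem theorem4p1 (k : closedFieldType) :
  (forall (K G : affine_group k) (i : group_morphism K G) (R : module_algebra G),
      closed_inclusion i ->
      linearly_reductive (restrict_algebra i (translation_algebra G)) ->
      linearly_reductive R ->
      linearly_reductive (restrict_algebra i R))
  /\
  (forall (K G : affine_group k) (i : group_morphism K G) (R : module_algebra G),
      closed_inclusion i -> normal_inclusion i ->
      forall Q : quotient_group i,
      linearly_reductive R <->
      (linearly_reductive (restrict_algebra i R) /\
       linearly_reductive (fixed_algebra Q R))).
Proof.
split=> [K G i R _ lrK lrG|K G i R iclosed norm Q].
  apply: has_integrals_linearly_reductive.
  by apply: has_integrals_restrict; exact: linearly_reductive_has_integrals.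
split=> [/linearly_reductive_has_integrals intG|[lrK lrQ]].
  split; apply: has_integrals_linearly_reductive.
    (* For a normal inclusion the integrals on [k[G]] are constructed rather than assumed. *)
    exact: has_integrals_restrict (has_integrals_normal iclosed norm) intG.
  exact: has_integrals_fixed.
apply: has_integrals_linearly_reductive.
by apply: (@has_integrals_extension _ _ _ _ Q);
  exact: linearly_reductive_has_integrals.
Qed.
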